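(* Let $\Omega$ be a countable set and let $K\subset S(\Omega)$ be a perfect oligomorphic group. Let $A$ range over the perfect subsets of $\Omega$. (a) The category $\mathrm{Tra}(K)$ is the train $\mathrm{Tra}(K,\{K(A)\})$ of the group $K$. That is: for all perfect sets $A,B$ and $g_1,g_2\in K$, the elements $g_1,g_2$ define the same reduced double coset in $[\![K(A)\backslash K/K(B)]\!]$ if and only if $g_1|_{B\to A}=g_2|_{B\to A}$, so that $g\mapsto g|_{B\to A}$ induces a bijection from $[\![K(A)\backslash K/K(B)]\!]$ onto $\mathrm{Mor}_{\mathrm{Tra}(K)}(B,A)$; for all perfect $A,B,C$ and all $\mathfrak p\in[\![K(A)\backslash K/K(B)]\!]$, $\mathfrak q\in[\![K(B)\backslash K/K(C)]\!]$ there is an element $\mathfrak p\circ\mathfrak q\in[\![K(A)\backslash K/K(C)]\!]$ with $$\widetilde\rho_{A,B}(\mathfrak p)\,\widetilde\rho_{B,C}(\mathfrak q)=\widetilde\rho_{A,C}(\mathfrak p\circ\mathfrak q)$$ for every unitary representation $\rho$ of $K$; and under the bijections $[\![K(A)\backslash K/K(B)]\!]\to\mathrm{Mor}_{\mathrm{Tra}(K)}(B,A)$ induced by $g\mapsto g|_{B\to A}$ (for all perfect $A,B$), the product $\circ$ corresponds to the product of partial bijections and the involution induced by $g\mapsto g^{-1}$ corresponds to the pseudoinverse. (b) The map $\rho\mapsto\widetilde\rho$ is a bijection between equivalence classes of unitary representations of $K$ and equivalence classes of $*$-representations of the category $\mathrm{Tra}(K)$.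
   Context: Countable means countably infinite. $S(\Omega)$ is the group of all permutations of $\Omega$ with the topology of pointwise convergence ($g_j\to g$ iff for each $\omega\in\Omega$, $g_j\omega=g\omega$ for all large $j$). A closed subgroup $K\subset S(\Omega)$ is oligomorphic if for every $n$ it has finitely many orbits on $\Omega^n$. For a finite $A\subset\Omega$, $K(A)$ is the subgroup of all $g\in K$ fixing $A$ pointwise; $A$ is perfect if $A$ is finite and all orbits of $K(A)$ on $\Omega\setminus A$ are infinite. For perfect $A$, $K^\circ(A)$ is the subgroup of all $g\in K$ with $gA=A$. $K$ is perfect oligomorphic if it is oligomorphic and for each open subgroup $H\subset K$ there is a perfect set $A$ with $K(A)\subset H\subset K^\circ(A)$. A partial bijection $\mu:X\to Y$ is a bijection from a subset $\mathrm{dom}\,\mu\subset X$ onto a subset $\mathrm{im}\,\mu\subset Y$. The product of $\mu:X\to Y$ and $\nu:Y\to Z$ is $\nu\mu:X\to Z$ with $\mathrm{dom}\,\nu\mu=\mu^{-1}(\mathrm{dom}\,\nu\cap\mathrm{im}\,\mu)$, $\nu\mu(x)=\nu(\mu(x))$. The pseudoinverse $\mu^*:Y\to X$ is the inverse bijection $\mathrm{im}\,\mu\to\mathrm{dom}\,\mu$. For perfect $A,B$ and $g\in K$, the restriction $g|_{A\to B}$ is the partial bijection $A\to B$ with domain $A\cap g^{-1}B$ given there by $g$. The category $\mathrm{Tra}(K)$: objects are the perfect subsets of $\Omega$; morphisms $A\to B$ are the partial bijections of the form $g|_{A\to B}$, $g\in K$; composition is the product of partial bijections (the set of morphisms is closed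 under this product); the involution is $\mu\mapsto\mu^*$. Unitary representations of $K$ are (strongly continuous and) in separable Hilbert spaces. For a unitary representation $\rho$ of $K$ in $\mathcal L$, $\mathcal L_A$ is the subspace of $K(A)$-fixed vectors, $P_A$ the orthogonal projection onto it, and $\widetilde\rho_{A,B}(g):=P_A\rho(g)|_{\mathcal L_B}:\mathcal L_B\to\mathcal L_A$. The set of reduced double cosets $[\![K(A)\backslash K/K(B)]\!]$ is the quotient of $K$ by the relation $g_1\sim g_2$ iff $\widetilde\rho_{A,B}(g_1)=\widetilde\rho_{A,B}(g_2)$ for all unitary representations $\rho$; thus $\widetilde\rho_{A,B}$ is defined on reduced double cosets. The train $\mathrm{Tra}(K,\{K(A)\})$ has the perfect sets as objects, $[\![K(A)\backslash K/K(B)]\!]$ as morphisms $B\to A$, the product $\circ$ determined by $\widetilde\rho_{A,B}(\mathfrak p)\widetilde\rho_{B,C}(\mathfrak q)=\widetilde\rho_{A,C}(\mathfrak p\circ\mathfrak q)$ for all $\rho$, and the involution induced by $g\mapsto g^{-1}$. A $*$-representation $(Q,\kappa)$ of a category with involution assigns to each object $V$ a separable Hilbert space $Q(V)$ and to each morphism $\mathfrak p:V\to W$ a bounded operator $\kappa_{W,V}(\mathfrak p):Q(V)\to Q(W)$ such that $\kappa_{Y,W}(\mathfrak q)\kappa_{W,V}(\mathfrak p)=\kappa_{Y,V}(\mathfrak q\mathfrak p)$, $\kappa_{W,V}(\mathfrak p)^*=\kappa_{V,W}(\mathfrak p^* )$, $\kappa_{V,V}(1_V)=1_{Q(V)}$.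 Two $*$-representations $(Q,\kappa)$, $(Q',\kappa')$ are equivalent if there are unitary operators $U(V):Q(V)\to Q'(V)$ with $\kappa'_{W,V}(\mathfrak p)U(V)=U(W)\kappa_{W,V}(\mathfrak p)$ for all $\mathfrak p$. In (b), $\widetilde\rho$ is the $*$-representation of $\mathrm{Tra}(K)$ with $Q(A)=\mathcal L_A$ and $\kappa_{A,B}(g|_{B\to A})=\widetilde\rho_{A,B}(g)$. *)

(* Defs.v *)
From HB Require Import structures.
From mathcomp Require Import all_boot all_order all_algebra.
From mathcomp Require Import generic_quotient.
From mathcomp Require Import all_classical reals topology.
From mathcomp Require Import complex ring lra.

Set Implicit Arguments.
Unset Strict Implicit.
Unset Printing Implicit Defensive.

Import Order.TTheory GRing.Theory Num.Theory.

Local Open Scope classical_set_scope.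
Local Open Scope ring_scope.

(** * The group S(Omega) and its subgroups *)

Record symgrp (Omega : Type) := SymGrp {
  sfun :> Omega -> Omega;
  sinv : Omega -> Omega;
  sfunK : cancel sfun sinv;
  sinvK : cancel sinv sfun }.

Section SymGrp.
Variable Omega : Type.
Implicit Types g h : symgrp Omega.

Lemma symgrpP g h : (forall w, g w = h w) -> g = h.
Proof.
case: g h => [f f' fK f'K] [k k' kK k'K] /= E.
have {}E : f = k by apply: funext.
subst k.
have E' : f' = k' by apply: funext => w; rewrite -{1}(k'K w) fK.
subst k'.
by rewrite (Prop_irrelevance fK kK) (Prop_irrelevance f'K k'K).
Qed.

HB.instance Definition _ := gen_eqMixin (symgrp Omega).
HB.instance Definition _ := gen_choiceMixin (symgrp Omega).

Definition sym_one : symgrp Omega := @SymGrp Omega id id (fun=> erefl) (fun=> erefl).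
Definition sym_mul g h : symgrp Omega :=
  SymGrp (can_comp (sfunK g) (sfunK h)) (can_comp (sinvK h) (sinvK g)).
Definition sym_inv g : symgrp Omega := SymGrp (sinvK g) (sfunK g).

Fact sym_mulA : associative sym_mul.
Proof. by move=> f g h; apply: symgrpP. Qed.
Fact sym_mul1 : left_id sym_one sym_mul.
Proof. by move=> g; apply: symgrpP. Qed.
Fact sym_mulr1 : right_id sym_one sym_mul.
Proof. by move=> g; apply: symgrpP. Qed.
Fact sym_mulV : left_inverse sym_one sym_inv sym_mul.
Proof. by move=> g; apply: symgrpP => w /=; rewrite sfunK. Qed.
Fact sym_mulrV : right_inverse sym_one sym_inv sym_mul.
Proof. by move=> g; apply: symgrpP => w /=; rewrite sinvK. Qed.

HB.instance Definition _ := isGroup.Build (symgrp Omega)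
  sym_mulA sym_mul1 sym_mulr1 sym_mulV sym_mulrV.

(* Pointwise convergence: a basic neighbourhood of g consists of the
   permutations that agree with g on a given finite set. *)
Definition sym_nbhs g : set_system (symgrp Omega) :=
  [set U : set (symgrp Omega) | exists2 A : set Omega, finite_set A &
     [set h : symgrp Omega | forall w, A w -> h w = g w] `<=` U].

HB.instance Definition _ := hasNbhs.Build (symgrp Omega) sym_nbhs.

Fact sym_nbhs_filter g : ProperFilter (nbhs g).
Proof.
apply: Build_ProperFilter_ex => [U [A _ AU]|]; first by exists g; apply: AU.
split => [|U V [A fA AU] [B fB BV]|U V UV [A fA AU]].
- by exists set0.
- exists (A `|` B); first by rewrite finite_setU.
  by move=> h hg; split; [apply: AU|apply: BV] => w Hw; apply: hg; [left|right].
- by exists A => //; apply: subset_trans AU UV.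
Qed.
Fact sym_nbhs_singleton g (U : set (symgrp Omega)) : nbhs g U -> U g.
Proof. by case=> A _; apply. Qed.
Fact sym_nbhs_nbhs g (U : set (symgrp Omega)) :
  nbhs g U -> nbhs g (nbhs^~ U).
Proof.
case=> A fA AU; exists A => // h hg; exists A => // k kh; apply: AU => w Aw.
by rewrite kh ?hg.
Qed.

HB.instance Definition _ := Nbhs_isNbhsTopological.Build (symgrp Omega)
  sym_nbhs_filter sym_nbhs_singleton sym_nbhs_nbhs.

End SymGrp.

Record subgroup (Omega : Type) := Subgroup {
  sg_set : set (symgrp Omega);
  sg_closed : group_closed (mem sg_set) }.

Definition sg_elt (Omega : Type) (K : subgroup Omega) : Type :=
  {g : symgrp Omega | g \in sg_set K}.
Coercion sg_elt : subgroup >-> Sortclass.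

HB.instance Definition _ Omega (K : subgroup Omega) :=
  SubChoice.copy (sg_elt K) {g : symgrp Omega | g \in sg_set K}.
HB.instance Definition _ Omega (K : subgroup Omega) :=
  SubChoice_isSubGroup.Build _ _ (sg_elt K) (sg_closed K).
HB.instance Definition _ Omega (K : subgroup Omega) :=
  Topological.copy (sg_elt K) (initial_topology (val : K -> symgrp Omega)).

Definition sg_val Omega (K : subgroup Omega) (g : K) : symgrp Omega := val g.
Coercion sg_val : sg_elt >-> symgrp.
Arguments sg_val {Omega K} g : simpl never.

(** * Perfect oligomorphic groups *)

Section Oligomorphic.
Variables (Omega : Type) (K : subgroup Omega).

Definition oligomorphic : Prop :=
  forall n : nat, finite_set
    [set O : set ('I_n -> Omega) |
       exists x : 'I_n -> Omega, O = [set g \o x | g in [set: K]]].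

(* K(A) *)
Definition fixer (A : set Omega) : set K :=
  [set g : K | forall a, A a -> g a = a].

(* K^o(A) *)
Definition stabilizer (A : set Omega) : set K :=
  [set g : K | g @` A = A].

Definition perfect (A : set Omega) : Prop :=
  finite_set A /\
  forall w, ~ A w -> infinite_set [set g w | g in fixer A].

Definition perfect_oligomorphic : Prop :=
  [/\ closed (sg_set K), oligomorphic &
      forall H : set K, open H -> group_closed (mem H) ->
        exists A, [/\ perfect A, fixer A `<=` H & H `<=` stabilizer A]].

Record perfset := PerfSet {
  pset :> set Omega;
  psetP : perfect pset }.

Lemma sg_val1 w : (1%g : K) w = w. Proof. by []. Qed.
Lemma sg_valM (g h : K) w : (g * h : K)%g w = g (h w).
Proof. by []. Qed.
Lemma sg_valK (g : K) w : (g^-1 : K)%g (g w) = w.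
Proof. by rewrite -sg_valM mulVg. Qed.
Lemma sg_valVK (g : K) w : g ((g^-1 : K)%g w) = w.
Proof. by rewrite -sg_valM mulgV. Qed.
Lemma sg_val_inj (g : K) : injective (g : Omega -> Omega).
Proof. exact: can_inj (sg_valK g). Qed.

Lemma fixerM A (g h : K) : fixer A g -> fixer A h -> fixer A (g * h)%g.
Proof. by move=> gA hA a Aa; rewrite sg_valM hA ?gA. Qed.
Lemma fixerV A (g : K) : fixer A g -> fixer A g^-1%g.
Proof. by move=> gA a Aa; rewrite -{1}(gA a Aa) sg_valK. Qed.

(* P. M. Neumann's separation lemma, used to show that the morphisms of
   Tra(K) are closed under composition. *)
Lemma neumann A (X Y : set Omega) : perfect A -> finite_set X ->
  (forall x, X x -> ~ A x) -> finite_set Y ->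
  exists2 g : K, fixer A g & forall x, X x -> ~ Y (g x).
Proof.
move=> [_ infA] /(@finite_seqP {classic Omega})[s ->].
elim: s Y => [|x s IH] Y sA fY; first by exists 1%g => // a Aa.
have /infinite_setD/(_ fY)/infinite_setN0 :
    infinite_set [set g x | g in fixer A] by apply: infA; apply: sA; exact: mem_head.
move=> [_ [[h hA <-] hxY]].
have kP y : {k : K | fixer A k /\
    ((exists2 k, fixer A k & k x = y) -> k x = y)}.
  apply: cid; case: (pselect (exists2 k, fixer A k & k x = y)).
    by case=> k kA kx; exists k.
  by move=> nk; exists 1%g; split=> // a Aa.
pose k y := sval (kP y).
pose Y' := Y `|` \bigcup_(y in Y) [set (k y * h^-1 : K)%g z | z in Y].
have fY' : finite_set Y'.
  rewrite finite_setU; split=> //; apply: bigcup_finite => // y _.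
  exact: finite_image.
have [|g gA gY'] := IH Y' _ fY'; first by move=> w ws; apply: sA; rewrite /mkset in_cons orbC ws.
have [gxY|gxY] := pselect (Y (g x)); last first.
  exists g => // w; rewrite /mkset in_cons => /predU1P[->//|/gY' H ?].
  by apply: H; left.
have [kA kx] : fixer A (k (g x)) /\ k (g x) x = g x.
  rewrite /k; case: (kP _) => /= k0 [k0A k0x]; split=> //.
  by apply: k0x; exists g.
exists (h * ((k (g x))^-1 * g))%g.
  by apply: fixerM => //; apply: fixerM => //; apply: fixerV.
move=> w; rewrite /mkset in_cons => /predU1P[->|/gY' ngw Yw].
  by rewrite 2!sg_valM -{2}kx sg_valK.
apply: ngw; right; exists (g x) => //; eexists; first exact: Yw.
by rewrite !sg_valM sg_valK sg_valVK.
Qed.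

End Oligomorphic.

(** * Partial bijections and the category Tra(K) *)

(* A partial bijection A -> B between subsets of Omega, given by its graph. *)
Record pbij (Omega : Type) (A B : set Omega) := PBij {
  graph : Omega -> Omega -> Prop;
  graph_sub : forall x y, graph x y -> A x /\ B y;
  graph_fun : forall x y y', graph x y -> graph x y' -> y = y';
  graph_inj : forall x x' y, graph x y -> graph x' y -> x = x' }.

Section PBij.
Variable Omega : Type.
Implicit Types A B C : set Omega.

Lemma pbijP A B (m n : pbij A B) :
  (forall x y, graph m x y <-> graph n x y) -> m = n.
Proof.
case: m n => [r a b c] [r' a' b' c'] /= E.
have {}E : r = r' by apply: funext => x; apply: funext => y; apply/propext/E.
subst r'; congr PBij; exact: Prop_irrelevance.
Qed.

Definition pdom A B (m : pbij A B) : set Omega :=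
  [set x | exists y, graph m x y].
Definition pim A B (m : pbij A B) : set Omega :=
  [set y | exists x, graph m x y].

#[local] Obligation Tactic := idtac.

Program Definition pb_id A : pbij A A :=
  @PBij _ A A (fun x y => A x /\ x = y) _ _ _.
Next Obligation. by move=> A x y [Ax <-]. Qed.
Next Obligation. by move=> A x y y' [_ <-] []. Qed.
Next Obligation. by move=> A x x' y [_ ->] []. Qed.

Program Definition pb_comp A B C (n : pbij B C) (m : pbij A B) : pbij A C :=
  @PBij _ A C (fun x z => exists2 y, graph m x y & graph n y z) _ _ _.
Next Obligation.
by move=> A B C n m x z [y xy yz]; have [? _] := graph_sub xy; have [] := graph_sub yz.
Qed.
Next Obligation.
move=> A B C n m x y y' [z Hz Hy] [z' Hz']; rewrite -(graph_fun Hz Hz').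
exact: graph_fun.
Qed.
Next Obligation.
move=> A B C n m x x' y [z Hz Hy] [z' Hz' Hy'].
by move: Hz'; rewrite -(graph_inj Hy Hy'); apply: graph_inj.
Qed.

Program Definition pb_star A B (m : pbij A B) : pbij B A :=
  @PBij _ B A (fun y x => graph m x y) _ _ _.
Next Obligation. by move=> A B m x y xy; have [] := graph_sub xy. Qed.
Next Obligation. by move=> A B m x y y'; exact: graph_inj. Qed.
Next Obligation. by move=> A B m x x' y; exact: graph_fun. Qed.

Lemma pdom_comp A B C (n : pbij B C) (m : pbij A B) :
  pdom (pb_comp n m) =
  [set x | exists2 y, graph m x y & (pdom n `&` pim m) y].
Proof.
apply/seteqP; split=> x.
  by case=> z [y xy yz]; exists y => //; split; [exists z|exists x].
by case=> y xy [[z yz] _]; exists z; exists y.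
Qed.

(* g|_{A -> B} *)
Program Definition restr (g : symgrp Omega) A B : pbij A B :=
  @PBij _ A B (fun x y => [/\ A x, B y & g x = y]) _ _ _.
Next Obligation. by move=> g A B x y []. Qed.
Next Obligation. by move=> g A B x y y' [_ _ <-] []. Qed.
Next Obligation.
by move=> g A B x x' y [_ _ <-] [_ _ /(can_inj (sfunK g))].
Qed.

Lemma pdom_restr g A B : pdom (restr g A B) = A `&` g @^-1` B.
Proof.
apply/seteqP; split=> x; first by case=> y [Ax By E]; split=> //=; rewrite E.
by case=> Ax Bx; exists (g x).
Qed.

End PBij.

Record icat := ICat {
  obj :> Type;
  mor : obj -> obj -> Type;
  mid : forall V, mor V V;
  mcomp : forall V W Y, mor W Y -> mor V W -> mor V Y;
  mstar : forall V W, mor V W -> mor W V;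
  mcompA : forall V W Y Z (p : mor V W) (q : mor W Y) (r : mor Y Z),
    mcomp r (mcomp q p) = mcomp (mcomp r q) p;
  mcomp1m : forall V W (p : mor V W), mcomp (mid W) p = p;
  mcompm1 : forall V W (p : mor V W), mcomp p (mid V) = p;
  mstarK : forall V W (p : mor V W), mstar (mstar p) = p;
  mstarM : forall V W Y (p : mor V W) (q : mor W Y),
    mstar (mcomp q p) = mcomp (mstar p) (mstar q) }.
Arguments mor {_} _ _.
Arguments mid {_} _.
Arguments mcomp {_ _ _ _} _ _.
Arguments mstar {_ _ _} _.

Section Tra.
Variables (Omega : Type) (K : subgroup Omega).
Implicit Types A B C : perfset K.

Record trahom A B := TraHom {
  tpb :> pbij A B;
  tpbP : exists g : K, tpb = restr g A B }.

Lemma trahomP A B (m n : trahom A B) : tpb m = tpb n -> m = n.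
Proof.
case: m n => [m Hm] [n Hn] /= E; subst n; congr TraHom.
exact: Prop_irrelevance.
Qed.

Definition tra_restr (g : K) A B : trahom A B :=
  TraHom (ex_intro _ g erefl).

Fact tra_id_subproof A : exists g : K, pb_id A = restr g A A.
Proof.
exists 1%g; apply: pbijP => x y; split=> [[Ax <-]|[Ax Ay <-]]; split=> //.
Qed.
Definition tra_id A : trahom A A := TraHom (tra_id_subproof A).

Fact tra_star_subproof A B (m : trahom A B) :
  exists g : K, pb_star m = restr g B A.
Proof.
case: m => m [g /= ->]; exists g^-1%g; apply: pbijP => x y; split.
  by case=> Ay Bx E; split=> //; rewrite -E sg_valK.
by case=> Bx Ay E; split=> //; rewrite -E sg_valVK.
Qed.
Definition tra_star A B (m : trahom A B) : trahom B A :=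
  TraHom (tra_star_subproof m).

Fact tra_comp_subproof A B C (n : trahom B C) (m : trahom A B) :
  exists g : K, pb_comp n m = restr g A C.
Proof.
case: n m => n [k /= ->] [m [g /= ->]].
have [fA _] := psetP A; have [fC _] := psetP C.
have fgA : finite_set ((g @` A) `\` B).
  by apply: finite_setD; apply: finite_image.
have fkC : finite_set ((k^-1 : K)%g @` C) by apply: finite_image.
have [|h hB hY] := neumann (psetP B) fgA _ fkC; first by move=> x [].
exists (k * (h * g))%g; apply: pbijP => x z; split.
  case=> y [Ax By gx] [_ Cz ky]; split=> //.
  by rewrite -ky -gx !sg_valM hB ?gx.
case=> Ax Cz E; have [Bgx|nBgx] := pselect (pset B (g x)).
  by exists (g x); split=> //; rewrite -E !sg_valM hB.
case: (hY (g x)); first by split=> //; exists x.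
by exists z => //; rewrite -E !sg_valM sg_valK.
Qed.
Definition tra_comp A B C (n : trahom B C) (m : trahom A B) : trahom A C :=
  TraHom (tra_comp_subproof n m).

Fact tra_compA A B C D (p : trahom A B) (q : trahom B C) (r : trahom C D) :
  tra_comp r (tra_comp q p) = tra_comp (tra_comp r q) p.
Proof.
apply/trahomP/pbijP => x z; split=> /=.
  by case=> y [w ? ?] ?; exists w => //; exists y.
by case=> w ? [y ? ?]; exists y => //; exists w.
Qed.
Fact tra_comp1m A B (p : trahom A B) : tra_comp (tra_id B) p = p.
Proof.
apply/trahomP/pbijP => x z; split=> /= [[y ? [_ <-]]//|xz].
by exists z => //; split=> //; case: (graph_sub xz).
Qed.
Fact tra_compm1 A B (p : trahom A B) : tra_comp p (tra_id A) = p.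
Proof.
apply/trahomP/pbijP => x z; split=> /= [[y [_ ->]]//|xz].
by exists x => //; split=> //; case: (graph_sub xz).
Qed.
Fact tra_starK A B (p : trahom A B) : tra_star (tra_star p) = p.
Proof. by apply/trahomP/pbijP. Qed.
Fact tra_starM A B C (p : trahom A B) (q : trahom B C) :
  tra_star (tra_comp q p) = tra_comp (tra_star p) (tra_star q).
Proof.
by apply/trahomP/pbijP => x z; split=> /= -[y]; exists y.
Qed.

Definition Tra : icat :=
  ICat tra_compA tra_comp1m tra_compm1 tra_starK tra_starM.

End Tra.

(** * Hilbert spaces *)

Definition cplx (R : realType) : numClosedFieldType := R[i].

Section Norm.
Variables (R : realType) (V : lmodType (cplx R)).
Variable d : {dot V for @Num.conj (cplx R)}.

Definition dot_norm (x : V) : R := Num.sqrt (complex.Re (d x x)).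

Definition dot_cvg (u : nat -> V) (l : V) : Prop :=
  forall e : R, 0 < e ->
  exists N, forall n, (N <= n)%N -> dot_norm (u n - l) < e.

Definition dot_cauchy (u : nat -> V) : Prop :=
  forall e : R, 0 < e ->
  exists N, forall m n, (N <= m)%N -> (N <= n)%N -> dot_norm (u m - u n) < e.

Lemma dot_parallelogram x y :
  d (x + y) (x + y) + d (x - y) (x - y) = d x x + d x x + (d y y + d y y).
Proof. by rewrite dnormD dnormB /=; ring. Qed.

End Norm.

Record hilbert (R : realType) := Hilbert {
  hsort :> lmodType (cplx R);
  hdot : {dot hsort for @Num.conj (cplx R)};
  hcomplete : forall u : nat -> hsort,
    dot_cauchy hdot u -> exists l, dot_cvg hdot u l }.
Arguments hdot {R h}.

Definition hnorm (R : realType) (H : hilbert R) (x : H) : R :=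
  dot_norm hdot x.

Definition hseparable (R : realType) (H : hilbert R) : Prop :=
  exists u : nat -> H, forall (x : H) (e : R), 0 < e ->
  exists n, hnorm (x - u n) < e.

Definition bounded_op (R : realType) (H H' : hilbert R) (T : H -> H') : Prop :=
  linear T /\ exists M : R, forall x, hnorm (T x) <= M * hnorm x.

Definition adjoint_op (R : realType) (H H' : hilbert R)
    (T : H -> H') (T' : H' -> H) : Prop :=
  forall x y, hdot (T x) y = hdot x (T' y).

Definition unitary_op (R : realType) (H H' : hilbert R) (U : H -> H') : Prop :=
  [/\ linear U, forall x y, hdot (U x) (U y) = hdot x y &
      forall y, exists x, U x = y].

Record csubspace (R : realType) (H : hilbert R) := CSubspace {
  cs_set : set H;
  cs_submod : submod_closed (mem cs_set);
  cs_closed : forall (u : nat -> H) l,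
    (forall n, cs_set (u n)) -> dot_cvg hdot u l -> cs_set l }.

Definition cs_elt (R : realType) (H : hilbert R) (S : csubspace H) : Type :=
  {x : H | x \in cs_set S}.

HB.instance Definition _ (R : realType) (H : hilbert R) (S : csubspace H) :=
  SubChoice.copy (cs_elt S) {x : H | x \in cs_set S}.
HB.instance Definition _ (R : realType) (H : hilbert R) (S : csubspace H) :=
  GRing.SubChoice_isSubLmodule.Build _ _ _ (cs_elt S)
    (GRing.submod_closed_semi (cs_submod S)).

Section SubHilbert.
Variables (R : realType) (H : hilbert R) (S : csubspace H).

Definition cs_dot (x y : cs_elt S) : cplx R := hdot (val x) (val y).

Fact cs_dot_bilinear :
  bilinear_for *%R (@Num.conj (cplx R) \; *%R) cs_dot.
Proof.
split=> [y|x] a u v; rewrite /cs_dot linearD linearZ /=.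
  by rewrite linearDl linearZl_LR.
by [].
Qed.
HB.instance Definition _ := bilinear_isBilinear.Build (cplx R) (cs_elt S) (cs_elt S)
  (cplx R) _ _ cs_dot cs_dot_bilinear.

Fact cs_dot_herm (x y : cs_elt S) :
  cs_dot x y = (-1) ^+ false * (cs_dot y x)^*.
Proof. exact: hermitian_subproof. Qed.
HB.instance Definition _ := isHermitianSesquilinear.Build (cplx R) (cs_elt S)
  false (@Num.conj (cplx R)) cs_dot cs_dot_herm.

Fact cs_dot_gt0 (x : cs_elt S) : x != 0 -> 0 < cs_dot x x.
Proof. by move=> x0; apply: neq0_dnorm_gt0; rewrite -(inj_eq val_inj) in x0. Qed.
HB.instance Definition _ := isDotProduct.Build (cplx R) (cs_elt S) cs_dot cs_dot_gt0.

Fact cs_complete (u : nat -> cs_elt S) :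
  dot_cauchy cs_dot u -> exists l, dot_cvg cs_dot u l.
Proof.
move=> cu; have [l ul] := hcomplete (cu : dot_cauchy hdot (fun n => val (u n))).
have Sl : l \in cs_set S.
  by apply/mem_set/(cs_closed _ ul) => n; apply/set_mem/(valP (u n)).
by exists (exist _ l Sl).
Qed.

Definition cs_hilbert : hilbert R := Hilbert cs_complete.

(* The orthogonal projection onto S; the element p exists and is unique by the
   projection theorem. *)
Definition orthoproj (x : H) : cs_hilbert :=
  xget 0 [set p : cs_hilbert |
            forall s : cs_hilbert, hdot (x - val p) (val s) = 0].

End SubHilbert.

(** * Unitary representations of K *)

Record urep (R : realType) (Omega : Type) (K : subgroup Omega) := URep {
  rspace : hilbert R;
  rho_of : K -> rspace -> rspace;
  rho_unitary : forall g, unitary_op (rho_of g);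
  rho1 : forall v, rho_of 1%g v = v;
  rhoM : forall g h v, rho_of (g * h)%g v = rho_of g (rho_of h v);
  rho_continuous : forall v (g : K) (e : R), 0 < e ->
    \forall h \near g, hnorm (rho_of h v - rho_of g v) < e;
  rspace_separable : hseparable rspace }.
Arguments rho_of {R Omega K} u g v.

Definition urep_equiv (R : realType) (Omega : Type) (K : subgroup Omega)
    (rho rho' : urep R K) : Prop :=
  exists U : rspace rho -> rspace rho', unitary_op U /\
    forall g v, U (rho_of rho g v) = rho_of rho' g (U v).

Section Tilde.
Variables (R : realType) (Omega : Type) (K : subgroup Omega).
Implicit Types (rho : urep R K) (A B C : perfset K).

Definition fixed_set rho (A : set Omega) : set (rspace rho) :=
  [set v | forall g : K, fixer A g -> rho_of rho g v = v].
Arguments fixed_set : clear implicits.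

Fact fixed_submod rho A : submod_closed (mem (fixed_set rho A)).
Proof.
have lin g : linear (rho_of rho g) by case: (rho_unitary rho g).
split=> [|a u v /set_mem uA /set_mem vA]; apply/mem_set => g gA.
  by have := lin g (-1) 0 0; rewrite scaler0 addr0 scaleN1r addNr.
by rewrite lin uA ?vA.
Qed.

Fact fixed_closed rho A (u : nat -> rspace rho) l :
  (forall n, fixed_set rho A (u n)) -> dot_cvg hdot u l -> fixed_set rho A l.
Proof.
move=> uA ul g gA; have [lin iso _] := rho_unitary rho g.
have rhoB x y : rho_of rho g (x - y) = rho_of rho g x - rho_of rho g y.
  by rewrite addrC -scaleN1r lin scaleN1r addrC.
set x := rho_of rho g l; apply/eqP; rewrite -subr_eq0.
rewrite -(dnorm_eq0 (@hdot R (rspace rho))) eq_le dnorm_ge0 andbT.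
have := dnorm_ge0 (@hdot R (rspace rho)) (x - l).
rewrite !lecE /= => /andP[/eqP im0 c0]; rewrite im0 eqxx /= leNgt; apply/negP => c1.
set c := complex.Re _ in c0 c1.
have e0 : 0 < Num.sqrt c / 2 by rewrite divr_gt0 ?sqrtr_gt0.
have [N /(_ N (leqnn N))] := ul _ e0.
rewrite -[X in X < _]ger0_norm ?sqrtr_ge0 // -[X in _ < X]ger0_norm ?(ltW e0) //.
rewrite -ltr_sqr ?nnegrE // !real_normK ?num_real // exprMn !sqr_sqrtr //; last first.
  by have := dnorm_ge0 (@hdot R (rspace rho)) (u N - l); rewrite lecE => /andP[].
set b := u N - l; set a := rho_of rho g b => bc.
have xE : x - l = - a + b.
  by rewrite /a rhoB (uA N g gA) opprB -/x subrKA.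
have ReD (z w : R[i]) : complex.Re (z + w) = complex.Re z + complex.Re w.
  by case: z w => ? ? [].
have := dnorm_ge0 (@hdot R (rspace rho)) (- a - b).
rewrite lecE => /andP[_ /= d0].
have : hdot (x - l) (x - l) + hdot (- a - b) (- a - b) =
    hdot b b + hdot b b + (hdot b b + hdot b b).
  have aa : hdot (- a) (- a) = hdot b b.
    by rewrite linearNl linearNr opprK; exact: iso.
  by rewrite xE dot_parallelogram aa.
move=> /(congr1 (@complex.Re R)); rewrite !ReD -/c => cE.
suff : c < c by rewrite ltxx.
lra.
Qed.

(* L_A *)
Definition fixed_space rho A : csubspace (rspace rho) :=
  CSubspace (fixed_submod rho A) (@fixed_closed rho A).

(* rho~_{A,B}(g) = P_A rho(g) |_{L_B} *)
Definition tilde_op rho A B (g : K)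
    (v : cs_hilbert (fixed_space rho B)) : cs_hilbert (fixed_space rho A) :=
  orthoproj (fixed_space rho A) (rho_of rho g (val v)).
Arguments tilde_op : clear implicits.

Definition red_eq A B (g1 g2 : K) : bool :=
  `[< forall rho : urep R K, tilde_op rho A B g1 = tilde_op rho A B g2 >].

Fact red_eq_refl A B : reflexive (red_eq A B).
Proof. by move=> g; apply/asboolP. Qed.
Fact red_eq_sym A B : symmetric (red_eq A B).
Proof.
by move=> g h; apply/asboolP/asboolP => E rho; rewrite E.
Qed.
Fact red_eq_trans A B : transitive (red_eq A B).
Proof.
by move=> h g k /asboolP gh /asboolP hk; apply/asboolP => rho; rewrite gh.
Qed.

Canonical red_equiv A B :=
  EquivRel (red_eq A B) (red_eq_refl A B) (red_eq_sym A B) (@red_eq_trans A B).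

(* [[K(A) \ K / K(B)]] *)
Definition rdcoset A B := {eq_quot (red_equiv A B)}%qT.

Definition rdc A B (g : K) : rdcoset A B := \pi_(rdcoset A B)%qT g.

Definition rdc_tilde rho A B (p : rdcoset A B) :
    cs_hilbert (fixed_space rho B) -> cs_hilbert (fixed_space rho A) :=
  tilde_op rho A B (repr p).
Arguments rdc_tilde rho {A B} p.

Lemma rdcP A B (g1 g2 : K) : rdc A B g1 = rdc A B g2 <->
  forall rho : urep R K, tilde_op rho A B g1 = tilde_op rho A B g2.
Proof.
split=> [/eqmodP/asboolP//|E]; apply/eqmodP; exact/asboolP.
Qed.

Lemma rdc_tildeE rho A B (g : K) :
  rdc_tilde rho (rdc A B g) = tilde_op rho A B g.
Proof.
by apply: (rdcP A B _ _).1; rewrite /rdc reprK.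
Qed.

End Tilde.
Arguments fixed_set {R Omega K} rho A.
Arguments tilde_op {R Omega K} rho A B g v.
Arguments rdcoset R {Omega K} A B.
Arguments rdc R {Omega K} A B g.
Arguments rdc_tilde {R Omega K} rho {A B} p.

(** * *-representations of categories with involution *)

Record opsys (R : realType) (C : icat) := OpSys {
  ospace : C -> hilbert R;
  oper : forall V W : C, mor V W -> ospace V -> ospace W }.
Arguments oper {R C} o {V W} p v.

Definition star_rep (R : realType) (C : icat) (T : opsys R C) : Prop :=
  [/\ (forall V, hseparable (ospace T V)) /\
      (forall V W (p : mor V W), bounded_op (oper T p)),
      forall V W Y (p : mor V W) (q : mor W Y) v,
        oper T q (oper T p v) = oper T (mcomp q p) v,
      forall V W (p : mor V W), adjoint_op (oper T p) (oper T (mstar p)) &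
      forall V v, oper T (mid V) v = v].

Definition star_rep_equiv (R : realType) (C : icat) (T T' : opsys R C) : Prop :=
  exists U : forall V, ospace T V -> ospace T' V,
    (forall V, unitary_op (U V)) /\
    forall V W (p : mor V W) v, oper T' p (U V v) = U W (oper T p v).

(* rho~: a morphism mu : B -> A is of the form g|_{B -> A}; one such g is
   chosen to define the operator. *)
Definition tilde (R : realType) (Omega : Type) (K : subgroup Omega)
    (rho : urep R K) : opsys R (Tra K) :=
  @OpSys R (Tra K) (fun A => cs_hilbert (fixed_space rho A))
    (fun B A (mu : trahom B A) => tilde_op rho A B (sval (cid (tpbP mu)))).

(* Main.v *)
(* Everything rests on the identity P_A P_B = P_(A :&: B) for perfect A and B.
   A vector v fixed by K(B) has finitely many matrix coefficients <gv, v>, since K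
   has finitely many double cosets modulo K(B).  This finiteness passes to the weak
   closure of the orbit Kv.  A point of minimal norm in the weak closure of K(A)v
   has a finite K(A)-orbit, and perfectness of K turns this into K(A)-invariance:
   so P_A v lies in the weak closure of K(A)v.  Iterating P_B P_A, whose iterates
   have only finitely many possible norms, one reaches L_A and L_B, whose
   intersection is L_(A :&: B) because K(A) and K(B) generate K(A :&: B).

   Hence P_A rho(g) v = rho(g) P_(B :&: g^-1 A) v for v in L_B depends only on
   g|_(B -> A), and rho~ is a *-representation.  Conversely, a *-representation T is
   realized by K on the bounded families (x_A) with x_A in T(A) compatible with
   restriction, a Hilbert space in which the vectors fixed by K(A) form a copy of
   T(A) by Neumann's separation lemma.  Applied to T(A) = C^A this separates
   distinct partial bijections; applied to T = rho~ it gives back rho, because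
   the subspaces L_A span a dense subspace. *)
From HB Require Import structures.
From mathcomp Require Import all_boot all_order all_algebra.
From mathcomp Require Import generic_quotient.
From mathcomp Require Import all_classical reals topology.
From mathcomp Require Import complex ring lra.
Require Import Defs.

Set Implicit Arguments.
Unset Strict Implicit.
Unset Printing Implicit Defensive.

Import Order.TTheory GRing.Theory Num.Theory.

Local Open Scope classical_set_scope.
Local Open Scope ring_scope.

(** * Limits along ultrafilters *)

(** Two devices carry the analysis. Ultrafilters make bounded real functions converge: this gives
    weak limits of bounded sequences without subsequences, and the inner product of compatible
    families as a limit over the directed set of perfect sets. Minimizing [rdot x x - 2 * phi x]
    over a closed convex set gives Riesz representatives when the set is the whole space and a point
    of least norm when [phi] is 0; projections, weak limits and adjoints then come from Riesz.

    The obstacle in P_A P_B = P_(A :&: B) is that K(A) is not compact, so its orbits cannot be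
    averaged. Finiteness of the coefficients replaces compactness: a finite set of values survives
    approximation, a minimum over it is attained, and since <y, y> is isolated among the
    coefficients of y, distinct points of the orbit Ky stay a fixed distance apart. Alternating
    projections, which in general only converge, then stop after finitely many steps. *)

Section UltraLimit.
Variables (R : realType) (I : Type) (U : set_system I).
Implicit Types f g : I -> R.

Definition bfun f := exists M : R, forall i, `|f i| <= M.

Definition ucvg f (l : R) := forall e : R, 0 < e -> U [set i | `|f i - l| < e].

Definition ulim f : R := sup [set x | U [set i | x <= f i]].

Context {UU : UltraFilter U}.

(** Levels just below the supremum are exceeded on a set of [U]. A level above it is not, and for an
    ultrafilter this puts the complementary set in [U]. *)
Lemma ulimP f : bfun f -> ucvg f (ulim f).
Proof.
move=> [M fM] e e0; set S := [set x | U [set i | x <= f i]].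
have US i : - M <= f i /\ f i <= M by have := fM i; rewrite ler_norml => /andP[].
have S0 : S (- M) by apply: filterS filterT => i _ /=; have [] := US i.
have ubS : ubound S M.
  move=> x Sx; have [i /= xi] := filter_ex Sx.
  by apply: le_trans xi _; have [] := US i.
have supS : has_sup S by split; [exists (- M)|exists M].
have e2 : 0 < e / 2 by rewrite divr_gt0.
have [x Sx xl] := sup_adherent e2 supS.
have Uc : U (~` [set i | ulim f + e / 2 <= f i]).
  have [Sl|//] := in_ultra_setVsetC [set i | ulim f + e / 2 <= f i] UU.
  have : ulim f + e / 2 <= ulim f := sup_upper_bound supS Sl.
  by move=> h; exfalso; lra.
apply: filterS (filterI Sx Uc) => i /= [xi /negP]; rewrite -ltNge => il.
by rewrite ltr_norml; apply/andP; move: xl; rewrite -/(ulim f); split; lra.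
Qed.

Lemma ucvg_le f g l m : ucvg f l -> ucvg g m -> U [set i | f i <= g i] -> l <= m.
Proof.
move=> fl gm fg; rewrite leNgt; apply/negP => ml.
have e0 : 0 < (l - m) / 2 by rewrite divr_gt0 // subr_gt0.
have [i [[/= + +] +]] := filter_ex (filterI (filterI (fl _ e0) (gm _ e0)) fg).
by rewrite !ltr_norml => /andP[? ?] /andP[? ?] ?; lra.
Qed.

Lemma ucvg_cst c : ucvg (fun=> c) c.
Proof. by move=> e e0; apply: filterS filterT => i _ /=; rewrite subrr normr0. Qed.

Lemma ucvg_eq f g l : U [set i | f i = g i] -> ucvg f l -> ucvg g l.
Proof.
by move=> fg fl e e0; apply: filterS (filterI fg (fl _ e0)) => i /= [->].
Qed.

Lemma ucvg_unique f l m : ucvg f l -> ucvg f m -> l = m.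
Proof.
move=> fl fm; apply/eqP; rewrite eq_le.
by rewrite (ucvg_le fl fm) ?(ucvg_le fm fl) //; apply: filterS filterT => i _ /=.
Qed.

Lemma ucvgD f g l m : ucvg f l -> ucvg g m -> ucvg (fun i => f i + g i) (l + m).
Proof.
move=> fl gm e e0; have e2 : 0 < e / 2 by rewrite divr_gt0.
apply: filterS (filterI (fl _ e2) (gm _ e2)) => i /= [].
by rewrite !ltr_norml => /andP[? ?] /andP[? ?]; apply/andP; split; lra.
Qed.

Lemma ucvgZ f l c : ucvg f l -> ucvg (fun i => c * f i) (c * l).
Proof.
move=> fl e e0; have c0 : 0 < `|c| + 1 by rewrite ltr_wpDl.
have e2 : 0 < e / (`|c| + 1) by rewrite divr_gt0.
apply: filterS (fl _ e2) => i /= h.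
rewrite -mulrBr normrM; apply: le_lt_trans (_ : (`|c| + 1) * `|f i - l| < e).
  by rewrite ler_wpM2r // lerDl.
by rewrite mulrC -ltr_pdivlMr.
Qed.

Lemma ulim_unique f l : bfun f -> ucvg f l -> ulim f = l.
Proof. by move=> bf; apply: ucvg_unique; exact: ulimP. Qed.

End UltraLimit.

Lemma ultra_eventually : exists2 U : set_system nat, UltraFilter U & \oo `<=` U.
Proof. by have [U [UU oU]] := ultraFilterLemma eventually_filter; exists U. Qed.

(** * Hilbert spaces *)

Section RealDot.
Variables (R : realType) (H : hilbert R).
Implicit Types x y z : H.

Definition rc (a : R) : cplx R := Complex a 0.
Definition rdot x y : R := complex.Re (hdot x y).

Lemma ReD (a b : cplx R) : complex.Re (a + b) = complex.Re a + complex.Re b.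
Proof. by case: a b => ? ? []. Qed.
Lemma ReN (a : cplx R) : complex.Re (- a) = - complex.Re a.
Proof. by case: a. Qed.

Lemma rdotDl x y z : rdot (x + y) z = rdot x z + rdot y z.
Proof. by rewrite /rdot linearDl ReD. Qed.
Lemma rdotDr x y z : rdot x (y + z) = rdot x y + rdot x z.
Proof. by rewrite /rdot linearD ReD. Qed.
Lemma rdotNl x y : rdot (- x) y = - rdot x y.
Proof. by rewrite /rdot linearNl ReN. Qed.
Lemma rdotNr x y : rdot x (- y) = - rdot x y.
Proof. by rewrite /rdot linearNr ReN. Qed.
Lemma rdotBl x y z : rdot (x - y) z = rdot x z - rdot y z.
Proof. by rewrite rdotDl rdotNl. Qed.
Lemma rdotBr x y z : rdot x (y - z) = rdot x y - rdot x z.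
Proof. by rewrite rdotDr rdotNr. Qed.
Lemma rdot0l x : rdot 0 x = 0. Proof. by rewrite /rdot linear0l. Qed.
Lemma rdot0r x : rdot x 0 = 0. Proof. by rewrite /rdot linear0. Qed.
Lemma rdotC x y : rdot x y = rdot y x.
Proof. have E : hdot x y = @Num.conj (cplx R) (hdot y x).
  by have := hermC (@hdot R H) x y; rewrite expr0 mul1r.
by rewrite /rdot E; case: (hdot y x). Qed.
Lemma rdotZl a x y : rdot (rc a *: x) y = a * rdot x y.
Proof.
rewrite /rdot linearZl_LR /=; case: (hdot x y) => u v /=.
by rewrite mul0r subr0.
Qed.
Lemma rdotZr a x y : rdot x (rc a *: y) = a * rdot x y.
Proof. by rewrite rdotC rdotZl rdotC. Qed.

(** Conjugate linearity in the second variable turns the imaginary part into a real part at i y.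
    Complex identities thus reduce to real ones on sets stable under scalars. *)
Lemma hdotE x y : hdot x y = Complex (rdot x y) (rdot x (Complex 0 1 *: y)).
Proof.
rewrite /rdot linearZ /=; case: (hdot x y) => a b; congr Complex => /=.
by rewrite !mul0r mulN1r sub0r opprK.
Qed.

Lemma hdot_im x : hdot x x = rc (rdot x x).
Proof.
have := dnorm_ge0 (@hdot R H) x; rewrite lecE /rdot.
by case: (hdot x x) => a b /= /andP[/eqP -> _].
Qed.

Lemma rdot_ge0 x : 0 <= rdot x x.
Proof. by have := dnorm_ge0 (@hdot R H) x; rewrite lecE => /andP[]. Qed.

Lemma rdot_eq0 x : (rdot x x == 0) = (x == 0).
Proof. by rewrite -(dnorm_eq0 (@hdot R H)) hdot_im eq_complex /= eqxx andbT. Qed.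

Lemma hnorm2 x : hnorm x ^+ 2 = rdot x x.
Proof. by rewrite sqr_sqrtr // rdot_ge0. Qed.
Lemma hnorm_ge0 x : 0 <= hnorm x. Proof. exact: sqrtr_ge0. Qed.
Lemma hnorm_eq0 x : (hnorm x == 0) = (x == 0).
Proof. by rewrite -rdot_eq0 -hnorm2 sqrf_eq0. Qed.

Lemma hnorm_lt x (e : R) : 0 <= e -> (hnorm x < e) = (rdot x x < e ^+ 2).
Proof. by move=> e0; rewrite -hnorm2 ltr_pXn2r ?nnegrE // hnorm_ge0. Qed.
Lemma hnorm_le x (e : R) : 0 <= e -> (hnorm x <= e) = (rdot x x <= e ^+ 2).
Proof. by move=> e0; rewrite -hnorm2 ler_pXn2r ?nnegrE // hnorm_ge0. Qed.

Lemma rdot_CS x y : `|rdot x y| <= hnorm x * hnorm y.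
Proof.
rewrite -[X in _ <= X]ger0_norm ?mulr_ge0 ?hnorm_ge0 //.
rewrite -ler_sqr ?nnegrE // !real_normK ?num_real // exprMn !hnorm2.
have [->|y0] := eqVneq y 0; first by rewrite !rdot0r expr0n mulr0.
have yy : 0 < rdot y y by rewrite lt_def rdot_eq0 y0 rdot_ge0.
have := rdot_ge0 (rc (rdot y y) *: x - rc (rdot x y) *: y).
rewrite !(rdotBl, rdotBr, rdotZl, rdotZr) (rdotC y x).
set a := rdot x y; set b := rdot y y in yy *; set c := rdot x x.
rewrite [leRHS](_ : _ = b * (c * b - a ^+ 2)); last by ring.
by rewrite pmulr_rge0 // subr_ge0.
Qed.

Lemma hnormD x y : hnorm (x + y) <= hnorm x + hnorm y.
Proof.
rewrite hnorm_le ?addr_ge0 ?hnorm_ge0 // sqrrD !hnorm2 !(rdotDl, rdotDr) (rdotC y x).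
have := rdot_CS x y; rewrite ler_norml => /andP[_ h].
by rewrite mulr2n; lra.
Qed.
Lemma hnormN x : hnorm (- x) = hnorm x.
Proof. by congr Num.sqrt; rewrite -!/(rdot _ _) rdotNl rdotNr opprK. Qed.
Lemma hnormB x y : hnorm (x - y) = hnorm (y - x).
Proof. by rewrite -hnormN opprB. Qed.
Lemma hnormBD x y z : hnorm (x - z) <= hnorm (x - y) + hnorm (y - z).
Proof. by rewrite (le_trans _ (hnormD _ _)) // subrKA. Qed.

Lemma hnorm_small x : (forall e : R, 0 < e -> hnorm x < e) -> x = 0.
Proof.
move=> h; apply/eqP; rewrite -hnorm_eq0 eq_le hnorm_ge0 andbT leNgt.
by apply/negP => /h; rewrite ltxx.
Qed.

Lemma hdot0P x (S : set H) : (forall a s, S s -> S (a *: s)) ->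
  (forall s, S s -> rdot x s = 0) -> forall s, S s -> hdot x s = 0.
Proof. by move=> SZ x0 s Ss; rewrite hdotE (x0 _ Ss) (x0 _ (SZ _ _ Ss)). Qed.

Lemma parallelogram x y :
  rdot (x + y) (x + y) + rdot (x - y) (x - y) = 2 * rdot x x + 2 * rdot y y.
Proof. by rewrite !(rdotDl, rdotDr, rdotNl, rdotNr); ring. Qed.

Definition hclosed (S : set H) :=
  forall (u : nat -> H) l, (forall n, S (u n)) -> dot_cvg hdot u l -> S l.

(** Midpoints suffice for the parallelogram argument below. *)
Definition rconvex (S : set H) :=
  forall x y, S x -> S y -> S (rc (1 / 2) *: (x + y)).

End RealDot.

Section Arch.
Variable R : realType.
Lemma inv_nat_lt (e : R) : 0 < e -> exists N, forall n, (N <= n)%N -> n.+1%:R^-1 < e.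
Proof.
move=> e0; have [N hN] : exists N, e^-1 < N%:R.
  by exists (Num.Def.archi_bound e^-1); apply/archi_boundP; rewrite invr_ge0 ltW.
exists N => n Nn; rewrite invf_plt ?posrE //.
by rewrite (lt_le_trans hN) // ler_nat ltnW.
Qed.
End Arch.

(** * Minimization on closed convex sets and the Riesz theorem *)

Section Minimize.
Variables (R : realType) (H : hilbert R).
Variables (phi : H -> R) (M : R) (S : set H).
Hypothesis phiD : forall x y, phi (x + y) = phi x + phi y.
Hypothesis phiZ : forall a x, phi (rc a *: x) = a * phi x.
Hypothesis phiM : forall x, phi x <= M * hnorm x.
Hypotheses (S0 : S !=set0) (Sclosed : hclosed S) (Sconvex : rconvex S).

Let q x := rdot x x - 2 * phi x.

Let q_ge x : - M ^+ 2 <= q x.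
Proof.
have := phiM x; have := hnorm2 x; rewrite /q => <- h.
by have := sqr_ge0 (hnorm x - M); rewrite sqrrB => ?; nra.
Qed.

Let q_mid x y :
  rdot (x - y) (x - y) = 2 * q x + 2 * q y - 4 * q (rc (1 / 2) *: (x + y)).
Proof.
by have := parallelogram x y; rewrite /q phiZ phiD rdotZl rdotZr => h; lra.
Qed.

(** By [q_mid] the distance of two almost minimal points is controlled, because [q] at their
    midpoint is at least the infimum; so a minimizing sequence is Cauchy. *)
Lemma quadratic_min : exists2 m, S m &
  forall x, S x -> rdot m m - 2 * phi m <= rdot x x - 2 * phi x.
Proof.
pose E := [set q x | x in S].
have iE : has_inf E.
  split; first by case: S0 => x Sx; exists (q x); exists x.
  by exists (- M ^+ 2) => _ [x _ <-].
set m := inf E.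
have mq x : S x -> m <= q x by move=> Sx; apply: inf_lbound; [case: iE|exists x].
have uex n : exists x, S x /\ q x < m + n.+1%:R^-1.
  have [|_ [x Sx <-] ?] := @inf_adherent _ E (n.+1%:R^-1) _ iE; first by rewrite invr_gt0.
  by exists x.
have [u uP] := choice uex.
have uB k l : rdot (u k - u l) (u k - u l) <= 2 * k.+1%:R^-1 + 2 * l.+1%:R^-1.
  have [Sk qk] := uP k; have [Sl ql] := uP l.
  rewrite q_mid; have := mq _ (Sconvex Sk Sl); move: qk ql.
  by move: (q _) (q (u k)) (q (u l)) _^-1 _^-1 => a b c x y *; lra.
have uC : dot_cauchy hdot u.
  move=> e e0; have [|N hN] := @inv_nat_lt _ (e ^+ 2 / 4); first by rewrite divr_gt0 ?exprn_gt0.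
  exists N => k l Nk Nl; rewrite -/(hnorm _) hnorm_lt ?ltW //.
  have := uB k l; have := hN _ Nk; have := hN _ Nl.
  by move: (rdot _ _) (k.+1%:R^-1) (l.+1%:R^-1) => a b c *; lra.
have [l ul] := hcomplete uC.
have Sl : S l by apply: Sclosed ul => n; case: (uP n).
exists l => // x Sx; apply: le_trans (mq _ Sx); rewrite -/(q l).
rewrite leNgt; apply/negP => mql.
set d := q l - m; have d0 : 0 < d by rewrite subr_gt0.
(* Near [l], [q] drops by at most [C] times the distance. A point [v] of the sequence within
   [d / 2 / C] of [l] then has [q v > q l - d / 2 = m + d / 2], against its almost minimality. The
   [1] keeps [C] positive. *)
pose C := 2 * hnorm l + 2 * `|M| + 1.
have C0 : 0 < C by rewrite /C ltr_wpDl // addr_ge0 ?mulr_ge0 ?hnorm_ge0.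
have e0 : 0 < d / 2 / C by rewrite !divr_gt0.
have [N1 h1] := ul _ e0; have [|N2 h2] := @inv_nat_lt _ (d / 2); first by rewrite divr_gt0.
have := h1 (maxn N1 N2) (leq_maxl _ _); have := h2 (maxn N1 N2) (leq_maxr _ _).
set n := maxn N1 N2; have [_] := uP n; set v := u n => qv vd.
rewrite -/(hnorm (v - l)) => vl.
have qE : q v = q l + rdot (v - l) (v - l) + 2 * rdot l (v - l) - 2 * phi (v - l).
  have -> : q v = q (v - l + l) by rewrite subrK.
  rewrite /q phiD; move: (v - l) => z.
  by rewrite !(rdotDl, rdotDr) (rdotC z l); ring.
have := rdot_CS l (v - l); rewrite ler_norml => /andP[h3 _].
have h4 := phiM (v - l).
have h5 : M * hnorm (v - l) <= `|M| * hnorm (v - l).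
  by rewrite ler_wpM2r ?hnorm_ge0 ?ler_norm.
have h6 : C * hnorm (v - l) < d / 2 by rewrite mulrC -ltr_pdivlMr.
have h7 := rdot_ge0 (v - l); have h8 := hnorm_ge0 (v - l).
move: h3 h4 h5 h6 h7 h8 qE qv vd; rewrite /C /d.
move: (q v) (q l) (rdot l _) (rdot (v - l) _) (hnorm l) (hnorm (v - l)) (phi _).
by move: (n.+1%:R^-1) => a b c e f g h i *; nra.
Qed.

Lemma quadratic_min_unique m m' : S m -> S m' ->
  (forall x, S x -> rdot m m - 2 * phi m <= rdot x x - 2 * phi x) ->
  rdot m' m' - 2 * phi m' <= rdot m m - 2 * phi m -> m = m'.
Proof.
move=> Sm Sm' minm le_m'm; apply/eqP; rewrite -subr_eq0 -rdot_eq0 eq_le rdot_ge0 andbT.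
by rewrite q_mid; have := minm _ (Sconvex Sm Sm'); rewrite -/(q m) -/(q m') in le_m'm *; rewrite -/(q _); lra.
Qed.

End Minimize.

(** The representing vector is the minimizer of [rdot x x - 2 * phi x], where the first variation
    vanishes. *)
Lemma riesz (R : realType) (H : hilbert R) (phi : H -> R) (M : R) :
  (forall x y, phi (x + y) = phi x + phi y) ->
  (forall a x, phi (rc a *: x) = a * phi x) ->
  (forall x, phi x <= M * hnorm x) ->
  exists y, forall x, phi x = rdot x y.
Proof.
move=> phiD phiZ phiM.
have [|//|//|m _ minm] := @quadratic_min R H phi M setT phiD phiZ phiM _ _ _.
  by exists 0.
exists m => x.
have h t : 0 <= t * t * rdot x x + 2 * t * (rdot x m - phi x).
  have := minm (m + rc t *: x) I; rewrite phiD phiZ !(rdotDl, rdotDr, rdotZl, rdotZr).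
  by rewrite (rdotC m x) => ?; lra.
set c := rdot x m - phi x in h; set a := rdot x x in h.
have a0 : 0 <= a := rdot_ge0 x.
suff c0 : c = 0 by move: c0; rewrite /c; lra.
(* The best step is [- c / a]; replacing [a] by [a + 1] allows [a = 0] and still leaves a negative
   multiple of [c ^+ 2]. *)
have := h (- c / (a + 1)).
have -> : - c / (a + 1) * (- c / (a + 1)) * a + 2 * (- c / (a + 1)) * c =
   - (c ^+ 2 * ((a + 2) / (a + 1) ^+ 2)) by field; lra.
rewrite oppr_ge0 pmulr_lle0; last by rewrite divr_gt0 ?exprn_gt0 //; lra.
by move=> c2; apply/eqP; rewrite -sqrf_eq0 eq_le c2 sqr_ge0.
Qed.

(** * Orthogonal projections *)

Section Projection.
Variables (R : realType) (H : hilbert R) (S : csubspace H).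
Implicit Types x y s : H.

Lemma cs_setP : cs_set S 0 /\
  forall a x y, cs_set S x -> cs_set S y -> cs_set S (a *: x + y).
Proof.
have [S0 SD] := cs_submod S; split; first exact: set_mem S0.
by move=> a x y /mem_set Sx /mem_set Sy; apply/set_mem/SD.
Qed.
Lemma cs_setD x y : cs_set S x -> cs_set S y -> cs_set S (x + y).
Proof. by move=> Sx Sy; rewrite -[x]scale1r; apply: cs_setP.2. Qed.
Lemma cs_setZ a x : cs_set S x -> cs_set S (a *: x).
Proof. by move=> Sx; rewrite -[_ *: _]addr0; apply: cs_setP.2 => //; exact: cs_setP.1. Qed.
Lemma cs_setB x y : cs_set S x -> cs_set S y -> cs_set S (x - y).
Proof. by move=> Sx Sy; apply: cs_setD => //; rewrite -scaleN1r; apply: cs_setZ. Qed.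

Definition proj x : H := val (orthoproj S x).

Lemma proj_in x : cs_set S (proj x).
Proof. exact: set_mem (valP (orthoproj S x)). Qed.

(** [orthoproj] is a choice with default 0, so what must be shown is that a projection exists: it
    represents the functional [rdot _ x] on [S]. Real orthogonality becomes complex because [S] is
    stable under scalars. *)
Lemma proj_hdot x s : cs_set S s -> hdot (x - proj x) s = 0.
Proof.
move=> Ss; rewrite /proj /orthoproj; case: xgetP => [p _ pP|np].
  exact: (pP (exist _ s (mem_set Ss))).
exfalso.
have [| | |p pP] := @riesz R (cs_hilbert S) (fun t => rdot (val t) x) (hnorm x).
- by move=> a b; rewrite -rdotDl.
- by move=> a b; rewrite -rdotZl.
- by move=> a; apply: le_trans (ler_norm _) _; rewrite mulrC; apply: rdot_CS.
apply: (np p) => t; apply: (hdot0P (S := cs_set S)).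
- exact: cs_setZ.
- move=> u Su; rewrite rdotBl (rdotC x) (rdotC (val p)).
  by apply/eqP; rewrite subr_eq0; apply/eqP; exact: (pP (exist _ u (mem_set Su))).
- exact: set_mem (valP t).
Qed.

Lemma proj_rdotl x s : cs_set S s -> rdot (proj x) s = rdot x s.
Proof.
move=> Ss; apply/eqP; rewrite eq_sym -subr_eq0 -rdotBl.
by rewrite /rdot (proj_hdot x Ss).
Qed.

Lemma proj_uniq x p : cs_set S p ->
  (forall s, cs_set S s -> rdot p s = rdot x s) -> proj x = p.
Proof.
move=> Sp pP; apply/eqP; rewrite -subr_eq0 -rdot_eq0 rdotBl.
have Sd : cs_set S (proj x - p) by apply: cs_setB => //; exact: proj_in.
by rewrite proj_rdotl // pP // subrr.
Qed.

Lemma proj_id x : cs_set S x -> proj x = x.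
Proof. by move=> Sx; apply: proj_uniq. Qed.

Lemma proj_linear : linear proj.
Proof.
move=> a x y; apply: proj_uniq => [|s Ss].
  by apply: cs_setP.2; exact: proj_in.
have E z : hdot (proj z) s = hdot z s.
  by apply/eqP; rewrite eq_sym -subr_eq0 -linearBl /= proj_hdot.
by rewrite /rdot !linearDl !linearZl_LR /= !E.
Qed.
HB.instance Definition _ := GRing.isLinear.Build (cplx R) H H *:%R proj proj_linear.

Lemma proj_sa x y : rdot (proj x) y = rdot x (proj y).
Proof.
by rewrite -(proj_rdotl x (proj_in y)) rdotC -(proj_rdotl y (proj_in x)) rdotC.
Qed.

Lemma proj_pyth x : rdot x x = rdot (proj x) (proj x) + rdot (x - proj x) (x - proj x).
Proof.
rewrite !(rdotBl, rdotBr) (rdotC (proj x) x) -(proj_rdotl x (proj_in x)).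
by ring.
Qed.

Lemma proj_norm_le x : rdot (proj x) (proj x) <= rdot x x.
Proof. by rewrite (proj_pyth x) lerDl rdot_ge0. Qed.

Lemma hnorm_proj x : hnorm (proj x) <= hnorm x.
Proof. by rewrite hnorm_le ?hnorm_ge0 // hnorm2 proj_norm_le. Qed.

Lemma proj_norm_eq x : rdot x x <= rdot (proj x) (proj x) -> proj x = x.
Proof.
move=> h; apply/eqP; rewrite eq_sym -subr_eq0 -rdot_eq0 eq_le rdot_ge0 andbT.
by have := proj_pyth x; lra.
Qed.

End Projection.

(** * Perfect sets *)

Section Perfect.
Variables (Omega : Type) (K : subgroup Omega).
Implicit Types (A B D X : set Omega) (H : set K).

Lemma group_closedP H : group_closed (mem H) <->
  [/\ H 1%g, (forall g h, H g -> H h -> H (g * h)%g) & forall g, H g -> H g^-1%g].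
Proof.
split=> [[/set_mem H1 HD]|[H1 HM HV]]; last first.
  split; first exact/mem_set.
  by move=> g h /set_mem Hg /set_mem Hh; apply/mem_set/HM => //; apply: HV.
have HV g : H g -> H g^-1%g.
  by move=> /mem_set Hg; rewrite -[g^-1%g]mul1g; apply/set_mem/HD => //; exact/mem_set.
split=> // g h Hg Hh; rewrite -[h]invgK.
by apply/set_mem/HD; apply/mem_set => //; apply: HV.
Qed.

Lemma nbhs_agree (g : K) X : finite_set X -> nbhs g [set h : K | forall w, X w -> h w = g w].
Proof.
move=> fX.
apply: (@initial_continuous _ _ (val : K -> symgrp Omega) g
  [set h : symgrp Omega | forall w, X w -> h w = g w]).
by exists X.
Qed.

Lemma nbhsP_agree (g : K) (N : set K) : nbhs g N ->
  exists2 X, finite_set X & [set h : K | forall w, X w -> h w = g w] `<=` N.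
Proof.
case=> M [[V oV <-] Vg VN].
have [X fX XV] : nbhs (val g) V by apply: open_nbhs_nbhs.
by exists X => // h hX; apply: VN; apply: XV.
Qed.

Lemma open_subgroup H X : group_closed (mem H) -> finite_set X -> fixer X `<=` H -> open H.
Proof.
move=> /group_closedP[H1 HM HV] fX XH; rewrite openE => g Hg.
apply: filterS (nbhs_agree g fX) => h hg.
rewrite -[h]mul1g -(mulgV g) -mulgA; apply: HM => //; apply: XH => w Xw.
by rewrite sg_valM hg // sg_valK.
Qed.

Lemma perfect_mem A w : perfect K A -> finite_set [set g w | g in fixer (K:=K) A] -> A w.
Proof. by move=> [_ Ainf] fin; apply: contrapT => /Ainf. Qed.

Lemma perfect_mem_sub A D w : perfect K A -> finite_set D ->
  (forall g : K, fixer A g -> D (g w)) -> A w.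
Proof.
move=> pA fD DP; apply: perfect_mem pA _.
by apply: sub_finite_set fD => _ [g gA <-]; apply: DP.
Qed.

Lemma fixer_group_closed A : group_closed (mem (fixer (K:=K) A)).
Proof.
by apply/group_closedP; split=> [//|g h|g]; [apply: fixerM|apply: fixerV].
Qed.

Lemma stab_mem A (g : K) w : stabilizer A g -> A w -> A (g w).
Proof. by move=> gA Aw; rewrite -gA; exists w. Qed.

Lemma perfect_preim A (g : K) : perfect K A -> perfect K (g @^-1` A).
Proof.
move=> [fA iA].
have preimE : g @^-1` A = [set (g^-1 : K)%g w | w in A].
  apply/seteqP; split=> w.
    by move=> Aw; exists (g w) => //; rewrite sg_valK.
  by case=> v Av <-; rewrite /preimage /= sg_valVK.
split=> [|w nAw]; first by rewrite preimE; apply: finite_image.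
have := iA (g w) nAw; apply: contra_not => fin.
have : finite_set [set g z | z in [set h w | h in fixer (K:=K) (g @^-1` A)]].
  exact: finite_image.
apply: sub_finite_set => _ [h hA <-]; exists ((g^-1 * h * g : K)%g w); last by rewrite !sg_valM sg_valVK.
exists (g^-1 * h * g : K)%g => // a ga.
by rewrite !sg_valM hA // sg_valK.
Qed.

Definition preimP (g : K) (A : perfset K) : perfset K :=
  PerfSet (perfect_preim g (psetP A)).

Hypothesis perfK : perfect_oligomorphic K.

(** [H] is open, so K(D) is contained in [H] and [H] preserves [D] for some perfect [D]. Then K(A)
    preserves the finite set [D], whose points therefore have finite K(A)-orbits and lie in [A];
    likewise for [B]. With [H] the group generated by K(A) and K(B), this is the generation of K(A
    :&: B). *)
Lemma fixer_cap A B H : perfect K A -> perfect K B -> group_closed (mem H) ->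
  fixer A `<=` H -> fixer B `<=` H -> exists D, [/\ perfect K D, D `<=` A `&` B,
    fixer D `<=` H & fixer (A `&` B) `<=` H].
Proof.
move=> pA pB gH AH BH; have [_ _ /(_ H)[||D [pD DH HD]]] := perfK.
- by apply: (open_subgroup gH _ AH); case: pA.
- by [].
have sD C : perfect K C -> fixer C `<=` H -> D `<=` C.
  move=> pC CH d Dd; apply: (perfect_mem_sub (D := D)) pC _ _; first by case: pD.
  by move=> g /CH /HD/stab_mem; apply.
exists D; have DAB : D `<=` A `&` B by move=> d Dd; split; apply: sD Dd.
by split=> // g gAB; apply: DH => d /DAB; apply: gAB.
Qed.

(** [H] is the subgroup generated by K(A) and K(B). As K(D) lies in [H], which fixes [A :&: B]
    pointwise, a point of [A :&: B] is a one-point orbit of K(D), so it belongs to [D]. *)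
Lemma perfect_cap A B : perfect K A -> perfect K B -> perfect K (A `&` B).
Proof.
move=> pA pB.
pose H := [set g : K | forall H', group_closed (mem H') -> fixer A `<=` H' ->
  fixer B `<=` H' -> H' g].
have gH : group_closed (mem H).
  apply/group_closedP; split=> [H' /group_closedP[]//|g h Hg Hh H' gH' AH' BH'|g Hg H' gH' AH' BH'].
    by have /group_closedP[_ HM _] := gH'; apply: HM; [apply: Hg|apply: Hh].
  by have /group_closedP[_ _] := gH'; apply; apply: Hg.
have [D [pD DAB DH _]] := fixer_cap pA pB gH
  (fun g gA H' _ AH' _ => AH' g gA) (fun g gB H' _ _ BH' => BH' g gB).
suff -> : A `&` B = D by [].
apply/seteqP; split=> // w ABw; apply: (perfect_mem_sub (D := [set w])) pD _ _ => //.
move=> g /DH /(_ _ (fixer_group_closed (A `&` B))) gAB.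
by rewrite /= gAB // => h hA a [Aa Ba]; apply: hA.
Qed.

Lemma perfect_sup X : finite_set X -> exists A : perfset K, X `<=` A.
Proof.
move=> fX; have [_ _ /(_ (fixer X))[||D [pD DX _]]] := perfK.
- by apply: (open_subgroup (fixer_group_closed X) fX).
- exact: fixer_group_closed.
exists (PerfSet pD) => x Xx; apply: (perfect_mem_sub (D := [set x])) pD _ _ => //.
by move=> g /DX /(_ x Xx).
Qed.

Definition capP (A B : perfset K) : perfset K := PerfSet (perfect_cap (psetP A) (psetP B)).

End Perfect.

(** * Unitary representations *)

Section Rep.
Variables (R : realType) (Omega : Type) (K : subgroup Omega) (rho : urep R K).
Local Notation L := (rspace rho).
Implicit Types (v w x y : L) (g h : K).
Local Notation "g • v" := (rho_of rho g v) (at level 40, v at level 40).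

Lemma rho_linear g : linear (rho_of rho g). Proof. by case: (rho_unitary rho g). Qed.
HB.instance Definition _ g := GRing.isLinear.Build (cplx R) L L *:%R (rho_of rho g) (rho_linear g).

Lemma rho_hdot g x y : hdot (g • x) (g • y) = hdot x y.
Proof. by case: (rho_unitary rho g). Qed.
Lemma rho_rdot g x y : rdot (g • x) (g • y) = rdot x y.
Proof. by rewrite /rdot rho_hdot. Qed.
Lemma rhoK g x : g^-1%g • (g • x) = x.
Proof. by rewrite -rhoM mulVg rho1. Qed.
Lemma rhoVK g x : g • (g^-1%g • x) = x.
Proof. by rewrite -rhoM mulgV rho1. Qed.
Lemma rho_adj g x y : hdot (g • x) y = hdot x (g^-1%g • y).
Proof. by rewrite -{1}(rhoVK g y) rho_hdot. Qed.
Lemma rho_radj g x y : rdot (g • x) y = rdot x (g^-1%g • y).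
Proof. by rewrite /rdot rho_adj. Qed.
Lemma hnorm_rho g x : hnorm (g • x) = hnorm x.
Proof. by rewrite /hnorm /dot_norm rho_hdot. Qed.

Lemma fixed_sub (A B : set Omega) : A `<=` B -> fixed_set rho A `<=` fixed_set rho B.
Proof. by move=> AB v vA g gB; apply: vA => a /AB; apply: gB. Qed.

Lemma stab_group v : group_closed (mem [set g | g • v = v]).
Proof.
apply/group_closedP; split=> [|g h /= gv hv|g /= gv]; first by rewrite /= rho1.
  by rewrite rhoM hv gv.
by rewrite -{1}gv rhoK.
Qed.

Lemma fixed_rho (A : set Omega) g v : fixed_set rho (g @^-1` A) v -> fixed_set rho A (g • v).
Proof.
move=> vA h hA; apply: (can_inj (rhoK g^-1%g)); rewrite rhoK -rhoM -rhoM; apply: vA => a ga.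
by rewrite !sg_valM hA // sg_valK.
Qed.

Lemma fixed_rhoV (A : set Omega) g v : fixed_set rho A (g • v) -> fixed_set rho (g @^-1` A) v.
Proof.
move=> vA h hA; apply: (can_inj (rhoK g)).
rewrite -[RHS](vA (g * h * g^-1)%g); first by rewrite !rhoM rhoK.
by move=> a Aa; rewrite !sg_valM hA /preimage /= ?sg_valVK.
Qed.

Definition fproj (A : perfset K) : L -> L := proj (fixed_space rho A).
Local Notation P := fproj.

Lemma P_in (A : perfset K) x : fixed_set rho A (P A x). Proof. exact: (proj_in (fixed_space rho A) x). Qed.

Lemma P_rho (A : perfset K) g x : P A (g • x) = g • P (preimP g A) x.
Proof.
apply: proj_uniq => [|s As]; first exact: (@fixed_rho A g _ (@P_in (preimP g A) x)).
rewrite !rho_radj; apply: (@proj_rdotl _ _ (fixed_space rho (preimP g A))) => /=.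
by apply: fixed_rhoV; rewrite rhoVK.
Qed.

Hypothesis perfK : perfect_oligomorphic K.

Lemma fixed_cap A B v : perfect K A -> perfect K B ->
  fixed_set rho A v -> fixed_set rho B v -> fixed_set rho (A `&` B) v.
Proof.
move=> pA pB vA vB.
by have [D [_ _ _]] := fixer_cap perfK pA pB (stab_group v) vA vB.
Qed.

(** The stabilizer [H] of [y] in K(A) is open and of finite index in K(A). For the perfect [D]
    attached to [H], the [H]-orbits of points of [D] stay in [D], so their K(A)-orbits are finite;
    hence [D] is contained in [A] and K(A) in K(D), which is contained in [H]. *)
Lemma finite_orbit_fixed (A X : set Omega) y : perfect K A -> finite_set X ->
  fixed_set rho X y -> finite_set [set g • y | g in fixer A] -> fixed_set rho A y.
Proof.
move=> pA fX yX forb.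
pose H := [set g : K | fixer A g /\ g • y = y].
have gH : group_closed (mem H).
  have /group_closedP[s1 sM sV] := stab_group y.
  apply/group_closedP; split=> [|g h [? ?] [? ?]|g [? ?]]; split=> //.
  - exact: fixerM.
  - exact: sM.
  - exact: fixerV.
  - exact: sV.
have [_ _ /(_ H)[|//|D [pD DH HD]]] := perfK.
  apply: (@open_subgroup _ _ _ (A `|` X)) => //.
    by rewrite finite_setU; split=> //; case: pA.
  by move=> g gAX; split=> [a Aa|]; [|apply: yX => x Xx]; apply: gAX; [left|right].
have DA : D `<=` A.
  move=> d Dd; apply: perfect_mem pA _.
  (* [c z] represents the coset of [H] that carries [y] to [z]; the default only occurs off the
     orbit. *)
  pose c (z : L) : K := xget 1%g [set g | fixer A g /\ g • y = z].
  apply: (@sub_finite_set _ _ (\bigcup_(z in [set g • y | g in fixer A]) [set c z e | e in D])).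
    move=> _ [g gA <-]; exists (g • y); first by exists g.
    have [cA cy] : fixer A (c (g • y)) /\ c (g • y) • y = g • y.
      by rewrite /c; case: xgetP => [k _ //|/(_ g)]; case.
    exists (((c (g • y))^-1 * g : K)%g d); last by rewrite sg_valM sg_valVK.
    apply: stab_mem Dd; apply: HD; split; first by apply: fixerM => //; apply: fixerV.
    by rewrite rhoM -[X in _ • X]cy rhoK.
  by apply: bigcup_finite => // z _; apply: finite_image; case: pD.
by move=> g gA; have [] : H g by apply: DH => d /DA; apply: gA.
Qed.

End Rep.
Arguments fproj {R Omega K} rho A x.

Lemma finite_gap (R : realType) (F : set R) (r : R) : finite_set F ->
  exists2 e : R, 0 < e & forall a, F a -> `|a - r| < e -> a = r.
Proof.
move=> /finite_seqP[s ->]; elim: s => [|a s [e e0 IH]]; first by exists 1.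
have [->|ar] := eqVneq a r.
  by exists e => // b; rewrite /= in_cons => /predU1P[->//|]; apply: IH.
exists (Num.min e `|a - r|); first by rewrite lt_min e0 normr_gt0 subr_eq0.
move=> b; rewrite /= in_cons lt_min => /predU1P[->|bs /andP[be _]]; last exact: IH.
by rewrite ltxx andbF.
Qed.

Lemma finite_limit (R : realType) (F : set R) (r : R) : finite_set F ->
  (forall e : R, 0 < e -> exists2 a, F a & `|a - r| < e) -> F r.
Proof.
move=> fF lF; have [e e0 eP] := finite_gap r fF.
by have [a Fa /(eP _ Fa) <-] := lF _ e0.
Qed.

Lemma finite_min (R : realType) (F : set R) : finite_set F -> F !=set0 ->
  exists2 m, F m & forall a, F a -> m <= a.
Proof.
move=> /finite_seqP[s ->]; elim: s => [[x]//|a s IH _].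
case: s IH => [_|b s []].
- by exists a => [|c]; rewrite /= inE // => /eqP->.
- by exists b; rewrite /= mem_head.
- move=> m ms mP; have [am|ma] := leP a m.
    exists a => [|c]; rewrite /= in_cons ?eqxx // => /predU1P[->//|/mP].
    exact: le_trans.
  exists m => [|c]; rewrite /= in_cons; first by rewrite [m \in _]ms orbT.
  by move=> /predU1P[->|/mP//]; apply: ltW.
Qed.

Lemma infinite_seq (T : choiceType) (B : set T) : infinite_set B ->
  exists2 f : nat -> T, injective f & forall n, B (f n).
Proof.
move=> /infiniteP/card_leP/unsquash f; exists (fun n => val (f (to_setT n))).
  move=> m n /val_inj fmn.
  by have /(congr1 val) := @inj _ _ _ f _ _ (in_setT _) (in_setT _) fmn.
by move=> n; apply/set_mem/(valP (f (to_setT n))).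
Qed.

(** The limit of the functionals [rdot (f i)] is additive and bounded by [M], so Riesz represents
    it. *)
Lemma weak_ulim (R : realType) (H : hilbert R) (I : Type) (U : set_system I)
    (f : I -> H) (M : R) : UltraFilter U -> (forall i, hnorm (f i) <= M) ->
  exists y, forall z, ucvg U (fun i => rdot (f i) z) (rdot y z).
Proof.
move=> UU fM.
have bf z : bfun (fun i => rdot (f i) z).
  exists (M * hnorm z) => i; apply: le_trans (rdot_CS _ _) _.
  by rewrite ler_wpM2r ?hnorm_ge0.
have fP z : ucvg U (fun i => rdot (f i) z) (ulim U (fun i => rdot (f i) z)).
  exact: ulimP.
have [x y|a x|x|y yP] := @riesz R H (fun z => ulim U (fun i => rdot (f i) z)) M.
- apply: (ulim_unique (bf _)); apply: ucvg_eq _ (ucvgD (fP x) (fP y)).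
  by apply: filterS filterT => i _ /=; rewrite rdotDr.
- apply: (ulim_unique (bf _)); apply: ucvg_eq _ (ucvgZ a (fP x)).
  by apply: filterS filterT => i _ /=; rewrite rdotZr.
- apply: ucvg_le (fP x) (ucvg_cst _) _; apply: filterS filterT => i _ /=.
  apply: le_trans (ler_norm _) _; apply: le_trans (rdot_CS _ _) _.
  by rewrite ler_wpM2r ?hnorm_ge0.
by exists y => z; rewrite rdotC -yP.
Qed.

(** * Vectors with finitely many coefficients and weak closures of orbits *)

Section Tame.
Variables (R : realType) (Omega : Type) (K : subgroup Omega) (rho : urep R K).
Local Notation L := (rspace rho).
Implicit Types (v w x y z : L) (g h : K).
Local Notation "g • v" := (rho_of rho g v) (at level 40, v at level 40).
Local Notation P := (fproj rho).

Lemma P_rdotl (A : perfset K) x s : fixed_set rho A s -> rdot (P A x) s = rdot x s.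
Proof. exact: (@proj_rdotl _ _ (fixed_space rho A)). Qed.
Lemma P_hdotl (A : perfset K) x s : fixed_set rho A s -> hdot (P A x) s = hdot x s.
Proof.
move=> As; apply/eqP; rewrite eq_sym -subr_eq0 -linearBl /=.
by rewrite (@proj_hdot _ _ (fixed_space rho A)).
Qed.
Lemma P_id (A : perfset K) x : fixed_set rho A x -> P A x = x.
Proof. exact: (@proj_id _ _ (fixed_space rho A)). Qed.
Lemma P_uniq (A : perfset K) x p : fixed_set rho A p ->
  (forall s, fixed_set rho A s -> rdot p s = rdot x s) -> P A x = p.
Proof. exact: (@proj_uniq _ _ (fixed_space rho A)). Qed.
HB.instance Definition _ A := GRing.Linear.copy (P A) (proj (fixed_space rho A)).

Definition coef x : set R := [set rdot (g • x) x | g in [set: K]].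
Definition tame x := finite_set (coef x).

(* [y] lies in the weak closure of the [G]-orbit of [x]. *)
Definition wcl (G : set K) x y := forall (e : R) (s : seq L), 0 < e ->
  exists2 g, G g & forall z, z \in s -> `|rdot (g • x - y) z| < e.

Lemma wcl_refl (G : set K) x : G 1%g -> wcl G x x.
Proof.
by move=> G1 e s e0; exists 1%g => // z _; rewrite rho1 subrr rdot0l normr0.
Qed.

Lemma wclS (G G' : set K) x y : G `<=` G' -> wcl G x y -> wcl G' x y.
Proof. by move=> GG' xy e s e0; have [g /GG'] := xy e s e0; exists g. Qed.

Lemma wcl_trans (G : set K) x y z : (forall g h, G g -> G h -> G (g * h)%g) ->
  wcl G x y -> wcl G y z -> wcl G x z.
Proof.
move=> GM xy yz e s e0; have e2 : 0 < e / 2 by rewrite divr_gt0.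
have [h Gh hP] := yz _ s e2.
(* Testing against the vectors [h^-1 t] keeps the approximation of [y] by [g x] valid after applying
   [h]. *)
have [g Gg gP] := xy _ [seq h^-1%g • t | t <- s] e2.
exists (h * g)%g => [|t ts]; first exact: GM.
have := gP _ (map_f (fun t => h^-1%g • t) ts); have := hP _ ts.
rewrite !rdotBl -!rho_radj rhoM !ltr_norml => /andP[? ?] /andP[? ?].
by apply/andP; split; lra.
Qed.

Lemma coef_mem x g h : coef x (rdot (g • x) (h • x)).
Proof. by exists (h^-1 * g)%g => //; rewrite rhoM rho_radj invgK. Qed.

(** The inner product is not jointly weakly continuous, so the two occurrences of [y] in [<h y, y>]
    are replaced one after the other, the second test vector depending on the first translate. This
    approximates the value by coefficients of [x], a finite and hence closed set. *)
Lemma wcl_coef x y : tame x -> wcl setT x y -> coef y `<=` coef x.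
Proof.
move=> tx xy _ [h _ <-]; apply: finite_limit tx _ => e e0.
have e2 : 0 < e / 2 by rewrite divr_gt0.
have [g1 _ /(_ (h^-1%g • y))] := xy _ [:: h^-1%g • y] e2.
rewrite mem_head => /(_ isT).
have [g2 _ /(_ ((h * g1)%g • x))] := xy _ [:: (h * g1)%g • x] e2.
rewrite mem_head => /(_ isT) h2 h1.
exists (rdot (g2 • x) ((h * g1)%g • x)); first exact: coef_mem.
move: h1 h2; rewrite !rdotBl -!rho_radj -rhoM (rdotC y (_ • x)).
by rewrite !ltr_norml => /andP[? ?] /andP[? ?]; apply/andP; split; lra.
Qed.

Lemma wcl_tame x y : tame x -> wcl setT x y -> tame y.
Proof. by move=> tx xy; apply: sub_finite_set (wcl_coef tx xy) tx. Qed.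

(** The squared distance is [2 <y, y> - 2 <g y, h y>], and a coefficient within [e] of [<y, y>]
    equals it; whence [d = 2 e]. *)
Lemma tame_gap y : tame y -> exists2 d : R, 0 < d & forall g h,
  rdot (g • y - h • y) (g • y - h • y) < d -> g • y = h • y.
Proof.
move=> ty; have [e e0 eP] := finite_gap (rdot y y) ty.
exists (2 * e); first by rewrite mulr_gt0.
move=> g h; rewrite !(rdotBl, rdotBr) !rho_rdot (rdotC (h • y)) => lt_e.
have E : rdot (g • y) (h • y) = rdot y y.
  apply: eP; first exact: coef_mem.
  have := rdot_ge0 (g • y - h • y); rewrite !(rdotBl, rdotBr) !rho_rdot (rdotC (h • y)).
  by rewrite ltr_norml => ?; apply/andP; split; lra.
apply/eqP; rewrite -subr_eq0 -rdot_eq0; apply/eqP.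
by rewrite !(rdotBl, rdotBr) !rho_rdot (rdotC (h • y)) E; ring.
Qed.

Lemma tame_open y : tame y -> exists2 X : set Omega, finite_set X & fixed_set rho X y.
Proof.
move=> /tame_gap[d d0 dP].
have [|X fX XP] := nbhsP_agree (rho_continuous y (1 : K)%g (e := Num.sqrt d) _).
  by rewrite sqrtr_gt0.
exists X => // g gX; rewrite -[RHS]rho1; apply: dP.
have : hnorm (g • y - 1%g • y) < Num.sqrt d by apply: XP => w Xw; rewrite gX.
by rewrite hnorm_lt ?sqrtr_ge0 // sqr_sqrtr // ltW.
Qed.

(** [<g v, v>] depends only on the K-orbit of the tuple [t g], an enumeration of [B] followed by its
    image under [g]. Such orbits encode the double cosets of K(B), and oligomorphy in length [n + n]
    makes them finite in number. *)
Lemma tame_fixed (B : set Omega) v : oligomorphic K -> finite_set B ->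
  fixed_set rho B v -> tame v.
Proof.
move=> oK fB vB.
have [s sB] := (finite_seqP (B : set {classic Omega})).1 fB.
pose n := size s.
pose b (i : 'I_n) : Omega := tnth (in_tuple s) i.
have bB i : B (b i) by rewrite sB /= mem_tnth.
have Bb (w : Omega) : B w -> exists i, b i = w.
  by rewrite sB => /(tnthP (in_tuple s))[i ->]; exists i.
pose t (g : K) (i : 'I_(n + n)) := match fintype.split i with inl j => b j | inr j => g (b j) end.
pose f (O : set ('I_(n + n) -> Omega)) :=
  let g := xget 1%g [set g : K | O (t g)] in rdot (g • v) v.
apply: sub_finite_set _ (finite_image f (oK (n + n)%N)) => _ [g _ <-].
exists [set h \o t g | h in [set: K]]; first by exists (t g).
rewrite /f; case: xgetP => [g' _ [k _ kE]|/(_ g)]; last first.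
  by case; exists 1%g => //; apply: funext.
have kb (w : Omega) : B w -> k w = w.
  move=> /Bb[i <-]; have := congr1 (fun u => u (unsplit (inl i))) kE.
  by rewrite /t /comp unsplitK.
have kg (w : Omega) : B w -> k (g w) = (g' : K) w.
  move=> /Bb[i <-]; have := congr1 (fun u => u (unsplit (inr i))) kE.
  by rewrite /t /comp unsplitK.
have -> : g' • v = (k * g)%g • v.
  apply: (can_inj (@rhoK _ _ _ rho (k * g)^-1%g)).
  rewrite rhoK -rhoM vB // => w Bw.
  by rewrite sg_valM -kg // -(sg_valM k g) sg_valK.
by rewrite rhoM rho_radj (vB k^-1%g) //; apply: (@fixerV _ _ B k) => w; apply: kb.
Qed.

Hypothesis perfK : perfect_oligomorphic K.

(* A minimal-norm point of the weak closure has a finite orbit: a weak limit of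
   distinct translates would have the same norm, hence be a strong limit,
   against [tame_gap]. *)
Lemma P_wcl (A : perfset K) x : tame x -> wcl (fixer A) x (P A x).
Proof.
move=> tx; have fA1 : fixer A (1%g : K) by [].
pose E := [set rdot y y | y in wcl (fixer A) x].
have ET y : wcl (fixer A) x y -> tame y.
  by move=> xy; apply: wcl_tame tx _; apply: wclS xy.
have EF : E `<=` coef x.
  move=> _ [y xy <-]; apply: wcl_coef tx _ _ _; first exact: wclS xy.
  by exists 1%g => //; rewrite rho1.
(* The squared norms in the weak closure are coefficients of [x], so the minimum is attained. *)
have [||_ [y xy <-] ymin] := @finite_min _ E.
- exact: sub_finite_set EF tx.
- by exists (rdot x x); exists x => //; apply: wcl_refl.
have {}ymin z : wcl (fixer A) y z -> rdot y y <= rdot z z.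
  by move=> yz; apply: ymin; exists z => //; apply: wcl_trans xy yz; exact: fixerM.
have ty := ET _ xy.
have yfix : fixed_set rho A y.
  have [X fX yX] := tame_open ty.
  apply: (finite_orbit_fixed perfK (psetP A) fX yX).
  apply: contrapT => /infinite_seq[f finj fE].
  have fP n : {g : K | fixer A g /\ g • y = f n}.
    by apply: cid; have [g gA <-] := fE n; exists g.
  pose k n := sval (fP n).
  have kA n : fixer A (k n) by rewrite /k; case: (fP n) => ? [].
  have ky n : k n • y = f n by rewrite /k; case: (fP n) => ? [].
  have [U UU oU] := ultra_eventually.
  have [|y' y'P] := @weak_ulim R L nat U (fun n => k n • y) (hnorm y) UU.
    by move=> n; rewrite hnorm_rho.
  have yy' : wcl (fixer A) y y'.
    move=> e s e0.
    have : U [set n | forall z, z \in s -> `|rdot (k n • y - y') z| < e].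
      elim: s => [|z s IH]; first by apply: filterS filterT => n _ z; rewrite in_nil.
      apply: filterS (filterI (y'P z e e0) IH) => n /= [h1 h2] t.
      by rewrite in_cons => /predU1P[->|/h2//]; rewrite rdotBl.
    by move=> /filter_ex[n nP]; exists (k n).
  have [d d0 dP] := tame_gap ty.
  have le1 : rdot y y <= rdot y' y' := ymin _ yy'.
  (* Translates of [y] have norm at most that of [y'], so [<k n y, y'>] within [d / 8] of [<y', y'>]
     gives squared distance below [d / 4] from [y']; by the parallelogram law two such translates
     are at squared distance below [d]. *)
  have d8 : 0 < d / 8 by rewrite divr_gt0.
  have V := y'P y' _ d8.
  have Vd : U [set n | rdot (k n • y - y') (k n • y - y') < d / 4].
    apply: filterS V => n /=; rewrite ltr_norml => /andP[? ?].
    rewrite !(rdotBl, rdotBr) rho_rdot (rdotC y'); lra.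
  have [n /= nV] := filter_ex Vd.
  have [m [mV nm]] : exists m, rdot (k m • y - y') (k m • y - y') < d / 4 /\ (n < m)%N.
    have Um : U [set m | (n < m)%N] by apply: oU; exists n.+1.
    by have [m [? ?]] := filter_ex (filterI Vd Um); exists m.
  have fnm : f n = f m.
    rewrite -!ky; apply: dP.
    have -> : k n • y - k m • y = (k n • y - y') - (k m • y - y').
      by rewrite opprB subrKA.
    set p := k n • y - y' in nV *; set q := k m • y - y' in mV *.
    have := parallelogram p q; have := rdot_ge0 (p + q); lra.
  by rewrite (finj _ _ fnm) ltnn in nm.
(* Pairing with a K(A)-fixed [s] is constant on the orbit K(A)x, hence takes the same value at
   [y]. *)
suff -> : P A x = y by [].
apply: P_uniq yfix _ => s As.
apply/eqP; rewrite eq_sym -subr_eq0; apply/eqP.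
apply: contrapT => /eqP ne; have e0 : 0 < `|rdot x s - rdot y s| by rewrite normr_gt0.
have [g gA /(_ s)] := xy _ [:: s] e0; rewrite mem_head => /(_ isT).
by rewrite rdotBl rho_radj As ?ltxx //; apply: fixerV.
Qed.

(* With [T = P_B P_A P_B], the vectors [T^n v] lie in the weak closure of [K v],
   so that their norms take finitely many values and [T^n v] is eventually fixed
   by [P_A]; as [T] is self-adjoint, this forces [P_A v] into [L_(A :&: B)]. *)
Lemma P_cap (A B : perfset K) v : fixed_set rho B v -> fixed_set rho (A `&` B) (P A v).
Proof.
move=> vB; pose D := capP perfK A B.
have DA : D `<=` A by move=> w [].
have DB : D `<=` B by move=> w [].
(* Once the component in L_D is removed, the claim becomes [P A v0 = 0]. *)
set v0 := v - P D v.
have PDB x : fixed_set rho B (P D x) by apply: (fixed_sub DB); exact: P_in.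
have v0B : fixed_set rho B v0 := @cs_setB _ _ (fixed_space rho B) _ _ vB (@PDB v).
have v0D s : fixed_set rho D s -> rdot v0 s = 0.
  by move=> sD; rewrite rdotBl P_rdotl // subrr.
suff Pv0 : P A v0 = 0.
  move: Pv0; rewrite linearB /= => /eqP; rewrite subr_eq0 => /eqP ->.
  by rewrite P_id; [|apply: (fixed_sub DA)]; exact: (@P_in _ _ _ rho D v).
pose T x := P B (P A (P B x)).
have Tsa x y : rdot (T x) y = rdot x (T y).
  by rewrite /T /fproj !proj_sa.
pose u n := iter n T v0.
have uB n : fixed_set rho B (u n) by case: n => [//|n]; exact: P_in.
have uD n s : fixed_set rho D s -> rdot (u n) s = 0.
  move=> sD; have sA := fixed_sub DA sD; have sB := fixed_sub DB sD.
  elim: n => [|n IH]; first exact: v0D.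
  by rewrite /u iterS P_rdotl // P_rdotl // P_rdotl.
have uS n : u n.+1 = P B (P A (u n)) by rewrite /u iterS -/(u n) /T (P_id (uB n)).
have tv0 : tame v0.
  have [_ oK _] := perfK; have [fB _] := psetP B.
  exact: tame_fixed oK fB v0B.
have uw n : wcl setT v0 (u n).
  elim: n => [|n IH]; first exact: wcl_refl.
  have tn : tame (u n) := wcl_tame tv0 IH.
  have w1 := wclS (@subsetT _ _) (P_wcl A tn).
  have w2 := wclS (@subsetT _ _) (P_wcl B (wcl_tame tn w1)).
  by rewrite uS; apply: wcl_trans (wcl_trans _ IH w1) w2.
(* At a minimum of the finitely many norms neither projection can shorten [u n]. *)
have [n un] : exists n, rdot (u n) (u n) <= rdot (u n.+1) (u n.+1).
  have [||_ [n _ <-] nP] := @finite_min _ [set rdot (u n) (u n) | n in setT].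
  - apply: sub_finite_set _ (tv0) => _ [n _ <-].
    by apply: (wcl_coef tv0 (uw n)); exists 1%g => //; rewrite rho1.
  - by exists (rdot (u 0) (u 0)); exists 0.
  - by exists n; apply: nP; exists n.+1.
have uA : fixed_set rho A (u n).
  suff <- : P A (u n) = u n by exact: P_in.
  apply: proj_norm_eq; apply: le_trans un _; rewrite uS; exact: proj_norm_le.
(* [u n] lies in both L_A and L_B, hence in L_D, to which it is orthogonal. *)
have un0 : u n = 0.
  apply/eqP; rewrite -rdot_eq0 uD //.
  exact: (fixed_cap perfK (psetP A) (psetP B) uA (uB n)).
have Tv0 : T v0 = 0.
  (* Self-adjointness gives [<u m.+1, u m.+1> = <u m.+2, u m>], so vanishing descends as far as
     [u 1 = T v0]. *)
  have u2 m : u m.+1 = 0 -> u m = 0 \/ m = 0%N.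
    case: m => [|m] E; [by right|left].
    by apply/eqP; rewrite -rdot_eq0 {2}/u iterS -/(u m) -Tsa -iterS -/(u m.+2) E rdot0l.
  have : u n.+1 = 0 by rewrite uS un0 !linear0.
  by elim: (n) => [//|m IH] /u2[/IH|].
apply/eqP; rewrite -rdot_eq0 P_rdotl; last exact: P_in.
have -> : rdot v0 (P A v0) = rdot v0 (T v0); last by rewrite Tv0 rdot0r.
have sa x y : rdot (P B x) y = rdot x (P B y) by exact: proj_sa.
by rewrite /T -sa !(P_id v0B).
Qed.

End Tame.

(** * The *-representation attached to a unitary representation *)

Section TildeRep.
Variables (R : realType) (Omega : Type) (K : subgroup Omega).
Hypothesis perfK : perfect_oligomorphic K.
Variable rho : urep R K.
Local Notation L := (rspace rho).
Local Notation "g • v" := (rho_of rho g v) (at level 40, v at level 40).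
Local Notation P := (fproj rho).
Implicit Types (A B C D : perfset K) (g h k : K) (v w : L).

Lemma P_hdotr A x s : fixed_set rho A s -> hdot s (P A x) = hdot s x.
Proof.
have hdC (y z : L) : hdot y z = @Num.conj (cplx R) (hdot z y).
  by have := hermC (@hdot R L) y z; rewrite expr0 mul1r.
by move=> As; rewrite hdC P_hdotl // -hdC.
Qed.

Lemma P_sub A B v : A `<=` B -> P A (P B v) = P A v.
Proof.
move=> AB; apply: P_uniq; first exact: P_in.
by move=> s As; rewrite P_rdotl // P_rdotl //; apply: (fixed_sub AB).
Qed.

Lemma P_capE A B v : fixed_set rho B v -> P A v = P (capP perfK A B) v.
Proof.
move=> vB; symmetry; apply: P_uniq; first exact: P_cap.
by move=> s sD; rewrite P_rdotl //; apply: fixed_sub sD => w [].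
Qed.

Lemma P_set_eq A B v : (A : set Omega) = B -> P A v = P B v.
Proof.
case: A B => [A pA] [B pB] /= E; subst B.
by rewrite (Prop_irrelevance pA pB).
Qed.

Lemma rho_agree g h (D : set Omega) v : fixed_set rho D v ->
  (forall x, D x -> g x = h x) -> g • v = h • v.
Proof.
move=> vD gh; apply: (can_inj (@rhoK _ _ _ rho h^-1%g)).
by rewrite rhoK -rhoM vD // => x Dx; rewrite sg_valM gh // sg_valK.
Qed.

Lemma P_rhoE A B g v : fixed_set rho B v ->
  P A (g • v) = g • P (capP perfK (preimP g A) B) v.
Proof. by move=> vB; rewrite P_rho (P_capE _ vB). Qed.

Lemma P_rho_eq A B g1 g2 v : fixed_set rho B v ->
  (forall x, pset B x -> pset A (g1 x) \/ pset A (g2 x) -> g1 x = g2 x) -> P A (g1 • v) = P A (g2 • v).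
Proof.
move=> vB g12; rewrite !(P_rhoE A _ vB).
have E : (capP perfK (preimP g1 A) B : set Omega) = capP perfK (preimP g2 A) B.
  apply/seteqP; split=> x [/= Ax Bx]; split=> //; rewrite /preimage /=.
    by rewrite -g12 //; left.
  by rewrite g12 //; right.
rewrite -(P_set_eq v E); apply: rho_agree; first exact: P_in.
by move=> x [Ax Bx]; apply: g12 => //; left.
Qed.

(** By [P_rhoE] used twice, the left side is [g h P_F v], where [F] consists of the [x] in [C] with
    [h x] in [B] and [g (h x)] in [A]. The hypotheses say that [F] is also the part of [C] sent into
    [A] by [k], and that [k = g h] there. *)
Lemma P_rho_comp A B C g h k v : fixed_set rho C v ->
  (forall x, pset C x -> pset B (h x) -> pset A (g (h x)) -> k x = g (h x)) ->
  (forall x, pset C x -> pset A (k x) -> pset B (h x) /\ k x = g (h x)) ->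
  P A (g • P B (h • v)) = P A (k • v).
Proof.
move=> vC c1 c2; rewrite (P_rhoE B h vC) (P_rhoE A k vC) -rhoM.
set E := capP _ _ _; rewrite (P_rhoE A _ (@P_in _ _ _ rho E v)).
set F := capP _ _ _; set G := capP _ _ _.
have FG : (F : set Omega) = G.
  apply/seteqP; split=> x.
    by case=> Ax [Bx Cx]; split=> //; rewrite /= /preimage /= c1.
  case=> Ax Cx; have [Bx kx] := c2 _ Cx Ax; split=> //.
  by move: Ax; rewrite /= /preimage /= kx.
rewrite P_sub; last by move=> x [].
rewrite (P_set_eq v FG); apply: rho_agree; first exact: P_in.
by rewrite -FG => x [Ax [Bx Cx]]; rewrite sg_valM c1.
Qed.

Lemma val_tilde_op A B g (v : cs_hilbert (fixed_space rho B)) : val (tilde_op rho A B g v) = P A (g • val v).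
Proof. by []. Qed.

Lemma cs_fixed A (v : cs_hilbert (fixed_space rho A)) : fixed_set rho A (val v).
Proof. exact: set_mem (valP v). Qed.

Lemma trahom_rep A B (m : trahom A B) : m = restr (sval (cid (tpbP m))) A B :> pbij A B.
Proof. by case: cid. Qed.

Lemma tilde_op_restr A B g1 g2 : restr g1 B A = restr g2 B A ->
  tilde_op rho A B g1 = tilde_op rho A B g2.
Proof.
move=> E; apply: funext => v; apply: val_inj; rewrite !val_tilde_op.
apply: P_rho_eq; first exact: cs_fixed.
have {E}E x y : graph (restr g1 B A) x y <-> graph (restr g2 B A) x y by rewrite E.
move=> x Bx [Ax|Ax].
  by have [/(_ (And3 Bx Ax erefl))[_ _ ->]] := E x (g1 x).
by have [_ /(_ (And3 Bx Ax erefl))[_ _ ->]] := E x (g2 x).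
Qed.

Lemma oper_tilde A B g :
  @oper R (Tra K) (tilde rho) B A (tra_restr g B A) = tilde_op rho A B g.
Proof. by apply: tilde_op_restr; rewrite -trahom_rep. Qed.

Lemma tilde_op_comp A B C g h k :
  restr k C A = pb_comp (restr g B A) (restr h C B) ->
  tilde_op rho A B g \o tilde_op rho B C h = tilde_op rho A C k.
Proof.
move=> E; apply: funext => v; apply: val_inj; rewrite /= !val_tilde_op.
have {E}E x y : graph (restr k C A) x y <->
  graph (pb_comp (restr g B A) (restr h C B)) x y by rewrite E.
apply: P_rho_comp; first exact: cs_fixed.
  move=> x Cx Bx Ax; have [_ H] := E x (g (h x)).
  by case: H => //; exists (h x).
move=> x Cx Ax; have [H _] := E x (k x).
by case: H => // y [_ By hx] [_ _ gy]; rewrite hx gy.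
Qed.

Lemma tilde_op_linear A B g : linear (tilde_op rho A B g).
Proof.
move=> a x y; apply: val_inj; rewrite val_tilde_op.
transitivity (a *: P A (g • val x) + P A (g • val y)); last by [].
by rewrite -(proj_linear (fixed_space rho A)) -rho_linear.
Qed.

Lemma tilde_star_rep : star_rep (tilde rho).
Proof.
split; first split.
- move=> A; have [u uP] := rspace_separable rho.
  exists (fun n => orthoproj (fixed_space rho A) (u n)) => x e e0.
  have [n xn] := uP (val x) e e0; exists n; apply: le_lt_trans xn.
  have -> : hnorm (x - orthoproj (fixed_space rho A) (u n)) =
            hnorm (P A (val x - u n)).
    by rewrite linearB /= P_id //; exact: cs_fixed.
  exact: hnorm_proj.
- move=> B A p; split; first exact: tilde_op_linear.
  exists 1 => x; rewrite mul1r; apply: le_trans (hnorm_proj _ _) _.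
  by rewrite hnorm_rho.
- move=> C B A p q v /=.
  rewrite -[LHS]/((tilde_op rho A B _ \o tilde_op rho B C _) v).
  rewrite (@tilde_op_comp _ _ _ _ _ (sval (cid (tpbP (tra_comp q p))))) //.
  by rewrite -!trahom_rep.
- move=> B A p v w /=; set g := sval _; set g' := sval _.
  have E : restr g' A B = restr (g^-1 : K)%g A B.
    have gE : p = restr g B A :> pbij B A := trahom_rep p.
    rewrite -[LHS](trahom_rep (tra_star p)); apply: pbijP => x y /=.
    rewrite gE; split=> -[Ay Bx E]; split=> //; rewrite -E.
      by rewrite [LHS]sg_valK.
    by rewrite [LHS]sg_valVK.
  rewrite (tilde_op_restr E).
  rewrite -[LHS]/(hdot (P A (g • val v)) (val w)) -[RHS]/(hdot (val v) (P B (g^-1%g • val w))).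
  rewrite P_hdotl ?P_hdotr; [|exact: cs_fixed..].
  exact: rho_adj.
- move=> A v /=; have E : restr (sval (cid (tpbP (tra_id A)))) A A = restr (1 : K)%g A A.
    rewrite -[LHS](trahom_rep (tra_id A)); apply: pbijP => x y; split=> [[Ax <-]|[Ax Ay <-]]; split=> //.
  rewrite (tilde_op_restr E); apply: val_inj; rewrite val_tilde_op rho1 P_id //.
  exact: cs_fixed.
Qed.

End TildeRep.

Lemma urep_equiv_tilde (R : realType) (Omega : Type) (K : subgroup Omega)
  (rho rho' : urep R K) : urep_equiv rho rho' -> star_rep_equiv (tilde rho) (tilde rho').
Proof.
move=> [U [[Ulin Uiso Usurj] Urho]].
have UB x y : U (x - y) = U x - U y by rewrite addrC -scaleN1r Ulin scaleN1r addrC.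
have Ufix (A : perfset K) v : fixed_set rho A v -> fixed_set rho' A (U v).
  by move=> vA g gA; rewrite -Urho vA.
have Uinj : injective U.
  move=> x y xy; apply/eqP; rewrite -subr_eq0 -rdot_eq0 /rdot -Uiso.
  by rewrite UB xy subrr linear0.
have UfixV (A : perfset K) v : fixed_set rho' A (U v) -> fixed_set rho A v.
  by move=> vA g gA; apply: Uinj; rewrite Urho vA.
have UP (A : perfset K) v : fproj rho' A (U v) = U (fproj rho A v).
  apply: P_uniq => [|s sA]; first by apply: Ufix; exact: P_in.
  have [t tE] := Usurj s; rewrite -tE in sA *.
  by rewrite /rdot !Uiso -!/(rdot _ _) P_rdotl //; apply: UfixV.
(* The projection only casts [U (val v)], already fixed by K(A), into the subspace type. *)
pose V (A : perfset K) (v : cs_hilbert (fixed_space rho A)) : cs_hilbert (fixed_space rho' A) :=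
  orthoproj (fixed_space rho' A) (U (val v)).
have VE A v : val (V A v) = U (val v).
  by rewrite -[LHS]/(fproj rho' A (U (val v))) UP P_id //; exact: cs_fixed.
exists V; split=> [A|B A p v].
  split=> [a x y|x y|y].
  - by apply: val_inj; rewrite VE !linearP /= !VE Ulin.
  - by rewrite -[LHS]/(hdot (val (V A x)) (val (V A y))) !VE Uiso.
  have [x xE] := Usurj (val y).
  have xA : fixed_set rho A x by apply: UfixV; rewrite xE; exact: cs_fixed.
  by exists (exist _ x (mem_set xA)); apply: val_inj; rewrite VE.
by apply: val_inj; rewrite VE /= !val_tilde_op VE -Urho UP.
Qed.

(** * The unitary representation attached to a *-representation *)

Section HilbertMore.
Variables (R : realType) (H : hilbert R).
Implicit Types x y : H.

Lemma rdotZZ (a : cplx R) x :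
  rdot (a *: x) (a *: x) = (complex.Re a ^+ 2 + complex.Im a ^+ 2) * rdot x x.
Proof.
rewrite {1}/rdot linearZl_LR linearZ /= hdot_im.
by case: a => p q /=; ring.
Qed.

Lemma rdot_le_sum x y : `|rdot x y| <= rdot x x + rdot y y.
Proof.
rewrite ler_norml; have := rdot_ge0 (x + y); have := rdot_ge0 (x - y).
have := rdot_ge0 x; have := rdot_ge0 y.
by rewrite !(rdotDl, rdotDr, rdotNl, rdotNr) (rdotC y x) => *; apply/andP; split; lra.
Qed.

Lemma rdotD_le x y : rdot (x + y) (x + y) <= 2 * rdot x x + 2 * rdot y y.
Proof. by rewrite -parallelogram lerDl rdot_ge0. Qed.

Lemma Im_hdot x y : complex.Im (hdot x y) = rdot x (Complex 0 1 *: y).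
Proof. by rewrite hdotE. Qed.

End HilbertMore.

Lemma hdot_isometry (R : realType) (H H' : hilbert R) (U : H -> H') : linear U ->
  (forall x, rdot (U x) (U x) = rdot x x) -> forall x y, hdot (U x) (U y) = hdot x y.
Proof.
move=> Ulin Uiso.
have UD x y : U (x + y) = U x + U y by rewrite -[x in LHS]scale1r Ulin scale1r.
have U0 : U 0 = 0 by apply/eqP; rewrite -rdot_eq0 Uiso rdot0l.
have UZ a x : U (a *: x) = a *: U x by rewrite -[_ *: _]addr0 Ulin U0 addr0.
have E x y : rdot (U x) (U y) = rdot x y.
  have := Uiso (x + y); rewrite UD !(rdotDl, rdotDr) !Uiso (rdotC y) (rdotC (U y)).
  by move=> ?; lra.
by move=> x y; rewrite !hdotE -UZ !E.
Qed.

Section Cofinal.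
Variables (Omega : Type) (K : subgroup Omega).
Hypothesis perfK : perfect_oligomorphic K.

Lemma cofinal_ultrafilter : exists U : set_system (perfset K), UltraFilter U /\
  forall A : perfset K, U [set B : perfset K | A `<=` B].
Proof.
pose F : set_system (perfset K) := [set S | exists2 X : set Omega, finite_set X &
  [set B : perfset K | X `<=` B] `<=` S].
have FF : ProperFilter F.
  apply: Build_ProperFilter_ex => [S [X fX XS]|].
    by have [A XA] := perfect_sup perfK fX; exists A; apply: XS.
  split=> [|S S' [X fX XS] [X' fX' XS']|S S' SS' [X fX XS]].
  - by exists set0.
  - exists (X `|` X'); first by rewrite finite_setU.
    by move=> B XB; split; [apply: XS|apply: XS'] => w Xw; apply: XB; [left|right].
  - by exists X => //; apply: subset_trans XS SS'.
have [U [UU FU]] := ultraFilterLemma FF; exists U; split=> // A.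
by apply: FU; exists (pset A) => //; case: (psetP A).
Qed.

Definition cofU : set_system (perfset K) := sval (cid cofinal_ultrafilter).
Global Instance cofU_ultra : UltraFilter cofU.
Proof. by rewrite /cofU; case: cid => ? []. Qed.
Lemma cofUP (A : perfset K) : cofU [set B : perfset K | A `<=` B].
Proof. by rewrite /cofU; case: cid => ? /= [_]; apply. Qed.

Lemma perfset_sup (A B : perfset K) : exists C : perfset K, A `<=` C /\ B `<=` C.
Proof.
have [|C ABC] := @perfect_sup _ _ perfK (A `|` B).
  by rewrite finite_setU; split; [case: (psetP A)|case: (psetP B)].
by exists C; split=> w Xw; apply: ABC; [left|right].
Qed.

End Cofinal.

(* [opsys] bundled with its axioms, so that the module structure below can be
   inferred from the type. *)
Record srep (R : realType) (Omega : Type) (K : subgroup Omega) := SRep {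
  sr_op :> opsys R (Tra K);
  srP : star_rep sr_op }.

Section Model.
Variables (R : realType) (Omega : Type) (K : subgroup Omega).
Variable T : srep R K.
Implicit Types (A B C : perfset K) (g h k : K).

Local Notation S A := (ospace T (A : Tra K)).

Definition Tm g A B : S A -> S B := @oper R (Tra K) T A B (tra_restr g A B).
Arguments Tm g A B v : clear implicits.

Lemma tra_restr_eq g h A B :
  (forall x, pset A x -> pset B (g x) \/ pset B (h x) -> g x = h x) ->
  tra_restr g A B = tra_restr h A B.
Proof.
move=> gh; apply/trahomP/pbijP => x y; split=> -[Ax By E]; split=> //.
  by rewrite -E; symmetry; apply: gh => //; left; rewrite E.
by rewrite -E; apply: gh => //; right; rewrite E.
Qed.

Lemma Tm_eq g h A B v :
  (forall x, pset A x -> pset B (g x) \/ pset B (h x) -> g x = h x) -> Tm g A B v = Tm h A B v.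
Proof. by move=> gh; rewrite /Tm (tra_restr_eq gh). Qed.

Lemma Tm_comp g h k A B C v :
  (forall x, pset A x -> pset B (h x) -> pset C (g (h x)) -> k x = g (h x)) ->
  (forall x, pset A x -> pset C (k x) -> pset B (h x) /\ k x = g (h x)) ->
  Tm g B C (Tm h A B v) = Tm k A C v.
Proof.
move=> c1 c2; have [_ Tc _ _] := srP T; rewrite /Tm Tc.
congr (oper T _ v); apply/trahomP/pbijP => x z; split.
  by case=> y [Ax By hx] [_ Cz gy]; subst; split=> //; apply: c1.
case=> Ax Cz kx; rewrite -kx in Cz *; have [Bx kE] := c2 _ Ax Cz.
by exists (h x) => //=; split=> //; rewrite kE in Cz *.
Qed.

Lemma Tm1 A v : Tm (1 : K)%g A A v = v.
Proof.
have [_ _ _ T1] := srP T; rewrite -[RHS]T1; congr (oper T _ v).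
apply/trahomP/pbijP => x y; split=> [[Ax _ <-]|[Ax <-]]; split=> //.
Qed.

Lemma Tm_lin g A B : linear (Tm g A B).
Proof. by have [[_ /(_ _ _ (tra_restr g A B))[]]] := srP T. Qed.
HB.instance Definition _ g A B :=
  GRing.isLinear.Build (cplx R) (S A) (S B) *:%R (Tm g A B) (@Tm_lin g A B).

Lemma Tm_adj g A B u w : hdot (Tm g A B u) w = hdot u (Tm g^-1%g B A w).
Proof.
have [_ _ Ta _] := srP T; rewrite Ta; congr (hdot u (oper T _ w)).
apply/trahomP/pbijP => x y; split=> -[Ay Bx E]; split=> //; rewrite -E.
  by rewrite [LHS]sg_valK.
by rewrite [LHS]sg_valVK.
Qed.

Lemma Tm1_adj A B u w : hdot (Tm 1%g A B u) w = hdot u (Tm 1%g B A w).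
Proof. by rewrite Tm_adj invg1. Qed.

Lemma Tm_iso g A B u w : (forall x, pset A x -> pset B (g x)) ->
  hdot (Tm g A B u) (Tm g A B w) = hdot u w.
Proof.
move=> AB; rewrite Tm_adj (@Tm_comp _ _ 1%g) ?Tm1 //.
  by move=> x _ _ _; rewrite sg_valK.
by move=> x Ax _; rewrite sg_valK; split=> //; apply: AB.
Qed.

Hypothesis perfK : perfect_oligomorphic K.

(** For [C] containing [A] and [B], the operator is the isometry from T(A) into T(C) followed by the
    adjoint of the isometry from T(B) into T(C). *)
Lemma Tm1_contr A B u : rdot (Tm 1%g A B u) (Tm 1%g A B u) <= rdot u u.
Proof.
have c (D C : perfset K) (w : S C) : D `<=` C ->
    rdot (Tm 1%g C D w) (Tm 1%g C D w) <= rdot w w.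
  move=> DC; set t := Tm 1%g C D w.
  have tt : rdot (Tm 1%g D C t) (Tm 1%g D C t) = rdot t t by rewrite /rdot Tm_iso.
  have E : rdot t t = rdot w (Tm 1%g D C t) by rewrite /rdot {1}/t Tm1_adj.
  have := rdot_ge0 (w - Tm 1%g D C t).
  by rewrite !(rdotBl, rdotBr) tt (rdotC _ w) -E; lra.
have [C [AC BC]] := perfset_sup perfK A B.
rewrite -(@Tm_comp 1%g 1%g _ _ C _ u) //; last by move=> x /AC.
by apply: le_trans (c _ _ _ BC) _; rewrite /rdot Tm_iso.
Qed.

End Model.
Arguments Tm {R Omega K} T g A B v.

(** * The Hilbert space of bounded compatible families *)

Section Families.
Variables (R : realType) (Omega : Type) (K : subgroup Omega).
Hypothesis perfK : perfect_oligomorphic K.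
Variable T : srep R K.
Implicit Types (A B C : perfset K) (g h k : K).

Local Notation S A := (ospace T (A : Tra K)).
Local Notation Tm := (Tm T).

(* The argument [perfK] is only carried by the type, so that the inner product,
   which needs it, is found by unification. *)
Record fam (pK : perfect_oligomorphic K) := Fam {
  fx :> forall A : perfset K, S A;
  fcompat : forall A B, A `<=` B -> Tm 1%g B A (fx B) = fx A;
  fbound : exists M, forall A, rdot (fx A) (fx A) <= M }.
Local Notation M := (fam perfK).
Implicit Types x y z : M.

Lemma famP x y : (forall A, x A = y A) -> x = y.
Proof.
case: x y => [x cx bx] [y cy by_] /= E.
have {}E : x = y by apply: functional_extensionality_dep.
subst y; congr Fam; exact: Prop_irrelevance.
Qed.

#[local] Obligation Tactic := idtac.

Program Definition fam0 : M := @Fam perfK (fun A => 0) _ _.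
Next Obligation. by move=> A B _ /=; rewrite linear0. Qed.
Next Obligation. by exists 0 => A; rewrite rdot0l. Qed.

Program Definition famD x y : M := @Fam perfK (fun A => x A + y A) _ _.
Next Obligation. by move=> x y A B AB /=; rewrite linearD /= !fcompat. Qed.
Next Obligation.
move=> x y; have [m mP] := fbound x; have [n nP] := fbound y.
exists (2 * m + 2 * n) => A; apply: le_trans (rdotD_le _ _) _.
by have := mP A; have := nP A; lra.
Qed.

Program Definition famZ (a : cplx R) x : M := @Fam perfK (fun A => a *: x A) _ _.
Next Obligation. by move=> a x A B AB /=; rewrite linearZ /= !fcompat. Qed.
Next Obligation.
move=> a x; have [m mP] := fbound x.
exists ((complex.Re a ^+ 2 + complex.Im a ^+ 2) * m) => A.
by rewrite rdotZZ ler_wpM2l // addr_ge0 ?sqr_ge0.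
Qed.

Definition famN x : M := famZ (-1) x.

HB.instance Definition _ := gen_eqMixin M.
HB.instance Definition _ := gen_choiceMixin M.

Fact famDA : associative famD. Proof. by move=> x y z; apply: famP => A; exact: addrA. Qed.
Fact famDC : commutative famD. Proof. by move=> x y; apply: famP => A; exact: addrC. Qed.
Fact famD0 : left_id fam0 famD. Proof. by move=> x; apply: famP => A; exact: add0r. Qed.
Fact famDN : left_inverse fam0 famN famD.
Proof. by move=> x; apply: famP => A /=; rewrite scaleN1r addNr. Qed.
HB.instance Definition _ := GRing.isZmodule.Build M famDA famDC famD0 famDN.

Fact famZA a b x : famZ a (famZ b x) = famZ (a * b) x.
Proof. by apply: famP => A; exact: scalerA. Qed.
Fact famZ1 : left_id 1 famZ. Proof. by move=> x; apply: famP => A; exact: scale1r. Qed.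
Fact famZDr : right_distributive famZ +%R.
Proof. by move=> a x y; apply: famP => A; exact: scalerDr. Qed.
Fact famZDl x : {morph famZ^~ x : a b / a + b}.
Proof. by move=> a b; apply: famP => A; exact: scalerDl. Qed.
HB.instance Definition _ := GRing.Zmodule_isLmodule.Build (cplx R) M famZA famZ1 famZDr famZDl.

Lemma fxP a x y A : (a *: x + y) A = a *: x A + y A. Proof. by []. Qed.
Lemma fxB x y A : (x - y) A = x A - y A. Proof. by rewrite /= scaleN1r. Qed.

Local Notation U := (cofU perfK).
Local Notation Re := (@complex.Re R).
Local Notation Im := (@complex.Im R).

(** On the diagonal [rdot (x A) (x A)] increases with [A], so the squared norm is a supremum; the
    ultrafilter also provides the values off the diagonal, with linearity inherited from the
    components. *)
Definition famdot x y : cplx R :=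
  Complex (ulim U (fun A => Re (hdot (x A) (y A)))) (ulim U (fun A => Im (hdot (x A) (y A)))).

Lemma bRe x y : bfun (fun A => Re (hdot (x A) (y A))).
Proof.
have [m mP] := fbound x; have [n nP] := fbound y.
exists (m + n) => A; apply: le_trans (rdot_le_sum _ _) _.
by rewrite lerD.
Qed.

Lemma bIm x y : bfun (fun A => Im (hdot (x A) (y A))).
Proof.
have [m mP] := fbound x; have [n nP] := fbound y.
exists (m + n) => A; rewrite Im_hdot; apply: le_trans (rdot_le_sum _ _) _.
by rewrite rdotZZ /= expr0n expr1n add0r mul1r lerD.
Qed.

Lemma cRe x y : ucvg U (fun A => Re (hdot (x A) (y A))) (Re (famdot x y)).
Proof. exact: (ulimP (bRe x y)). Qed.
Lemma cIm x y : ucvg U (fun A => Im (hdot (x A) (y A))) (Im (famdot x y)).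
Proof. exact: (ulimP (bIm x y)). Qed.

Lemma famdot_uniq x y (c : cplx R) :
  ucvg U (fun A => Re (hdot (x A) (y A))) (Re c) ->
  ucvg U (fun A => Im (hdot (x A) (y A))) (Im c) -> famdot x y = c.
Proof.
case: c => p q /= cp cq.
by rewrite /famdot (ulim_unique (bRe x y) cp) (ulim_unique (bIm x y) cq).
Qed.

Fact famdot_herm x y : famdot x y = (-1) ^+ false * (famdot y x)^*.
Proof.
rewrite expr0 mul1r; apply: famdot_uniq.
  have -> : Re (famdot y x)^* = Re (famdot y x) by case: (famdot y x).
  by apply: ucvg_eq _ (cRe y x); apply: filterS filterT => A _ /=; exact: rdotC.
have -> : Im (famdot y x)^* = - 1 * Im (famdot y x) by case: (famdot y x) => /= p q; rewrite mulN1r.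
apply: ucvg_eq _ (ucvgZ (-1) (cIm y x)); apply: filterS filterT => A _ /=.
have -> : hdot (x A) (y A) = @Num.conj (cplx R) (hdot (y A) (x A)).
  by have := hermC (@hdot R (S A)) (x A) (y A); rewrite expr0 mul1r.
by case: (hdot (y A) (x A)) => p q /=; rewrite mulN1r.
Qed.

Fact famdotPl y a u v : famdot (a *: u + v) y = a * famdot u y + famdot v y.
Proof.
have E A : hdot ((a *: u + v) A) (y A) = a * hdot (u A) (y A) + hdot (v A) (y A).
  by rewrite fxP linearDl linearZl_LR.
apply: famdot_uniq.
  have -> : Re (a * famdot u y + famdot v y) =
     Re a * Re (famdot u y) + (- Im a * Im (famdot u y) + Re (famdot v y)).
    by case: a {E} (famdot u y) (famdot v y) => p q [p' q'] [p2 q2] /=; ring.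
  apply: ucvg_eq _ (ucvgD (ucvgZ (Re a) (cRe u y)) (ucvgD (ucvgZ (- Im a) (cIm u y)) (cRe v y))).
  apply: filterS filterT => A _; rewrite /mkset E.
  by case: a {E} (hdot (u A) (y A)) (hdot (v A) (y A)) => p q [p' q'] [p2 q2] /=; ring.
have -> : Im (a * famdot u y + famdot v y) =
   Re a * Im (famdot u y) + (Im a * Re (famdot u y) + Im (famdot v y)).
  by case: a {E} (famdot u y) (famdot v y) => p q [p' q'] [p2 q2] /=; ring.
apply: ucvg_eq _ (ucvgD (ucvgZ (Re a) (cIm u y)) (ucvgD (ucvgZ (Im a) (cRe u y)) (cIm v y))).
apply: filterS filterT => A _; rewrite /mkset E.
by case: a {E} (hdot (u A) (y A)) (hdot (v A) (y A)) => p q [p' q'] [p2 q2] /=; ring.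
Qed.

Fact famdot_bilinear : bilinear_for *%R (@Num.conj (cplx R) \; *%R) famdot.
Proof.
split=> [y|x] a u v; first exact: famdotPl.
rewrite famdot_herm famdotPl expr0 mul1r rmorphD rmorphM /=.
by rewrite (famdot_herm x u) (famdot_herm x v) expr0 !mul1r.
Qed.
HB.instance Definition _ := bilinear_isBilinear.Build (cplx R) M M
  (cplx R) _ _ famdot famdot_bilinear.
HB.instance Definition _ := isHermitianSesquilinear.Build (cplx R) M
  false (@Num.conj (cplx R)) famdot famdot_herm.

Lemma fnorm_mono x A B : A `<=` B -> rdot (x A) (x A) <= rdot (x B) (x B).
Proof. by move=> AB; rewrite -(fcompat x AB); apply: Tm1_contr. Qed.

Lemma fnorm_ge x A : rdot (x A) (x A) <= Re (famdot x x).
Proof.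
apply: ucvg_le (ucvg_cst _) (cRe x x) _.
by apply: filterS (cofUP perfK A) => B; exact: fnorm_mono.
Qed.

Lemma fnorm_le x m : (forall A, rdot (x A) (x A) <= m) -> Re (famdot x x) <= m.
Proof.
move=> xm; apply: ucvg_le (cRe x x) (ucvg_cst _) _.
by apply: filterS filterT => A _; exact: xm.
Qed.

Fact famdot_gt0 x : x != 0 -> 0 < famdot x x.
Proof.
move=> x0; rewrite ltcE; apply/andP; split.
  rewrite /= eq_sym; apply/eqP; symmetry; apply: (ulim_unique (bIm x x)).
  by apply: ucvg_eq _ (ucvg_cst 0); apply: filterS filterT => A _ /=; rewrite hdot_im.
have [A xA] : exists A, x A != 0.
  apply: contrapT => nx; case/eqP: x0; apply: famP => A.
  by apply/eqP/negPn/negP => xA; apply: nx; exists A.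
apply: lt_le_trans (fnorm_ge x A).
by rewrite lt_def rdot_eq0 xA rdot_ge0.
Qed.
HB.instance Definition _ := isDotProduct.Build (cplx R) M famdot famdot_gt0.

Fact fam_complete (u : nat -> M) : dot_cauchy famdot u -> exists l, dot_cvg famdot u l.
Proof.
move=> cu.
have lt_n (z : M) (e : R) A : 0 < e -> dot_norm famdot z < e -> hnorm (z A) < e.
  move=> e0; rewrite hnorm_lt ?ltW // => h; apply: le_lt_trans (fnorm_ge z A) _.
  rewrite -(ltr_sqrt _ (exprn_gt0 _ e0)) sqrtr_sqr gtr0_norm //.
have cA A : exists l, dot_cvg (@hdot R (S A)) (fun n => u n A) l.
  apply: hcomplete => e e0; have [N NP] := cu e e0.
  exists N => m n Nm Nn; rewrite -fxB; apply: (lt_n _ _ A) => //; exact: NP.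
pose l A := sval (cid (cA A)).
have lP A (e : R) : 0 < e -> exists N, forall n, (N <= n)%N -> hnorm (u n A - l A) < e.
  by rewrite /l; case: cid => /= l' h; exact: h.
(* Convergence is uniform in [A] because every component is bounded by the whole norm. *)
have ul (e : R) : 0 < e -> exists N, forall n, (N <= n)%N -> forall A, hnorm (u n A - l A) < e.
  move=> e0; have e2 : 0 < e / 2 by rewrite divr_gt0.
  have [N NP] := cu _ e2; exists N => n Nn A.
  have [N' N'P] := lP A _ e2; set k := maxn N N'.
  apply: le_lt_trans (hnormBD _ (u k A) _) _.
  have h1 : hnorm (u n A - u k A) < e / 2.
    by rewrite -fxB; apply: (lt_n _ _ A) => //; apply: NP => //; exact: leq_maxl.
  by have := N'P k (leq_maxr _ _); lra.
have lc A B : A `<=` B -> Tm 1%g B A (l B) = l A.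
  move=> AB; apply/eqP; rewrite -subr_eq0; apply/eqP/hnorm_small => e e0.
  have e2 : 0 < e / 2 by rewrite divr_gt0.
  have [N NP] := ul _ e2; have h1 := NP N (leqnn N) A; have h2 := NP N (leqnn N) B.
  apply: le_lt_trans (hnormBD _ (u N A) _) _.
  have h3 : hnorm (Tm 1%g B A (l B) - u N A) <= hnorm (u N B - l B).
    rewrite -(fcompat (u N) AB) -linearB /= (hnormB (u N B)).
    by rewrite hnorm_le ?hnorm_ge0 // hnorm2 Tm1_contr.
  by lra.
have lb : exists m, forall A, rdot (l A) (l A) <= m.
  have [N NP] := ul 1 ltr01; have [m mP] := fbound (u N).
  exists (2 * 1 + 2 * m) => A.
  have -> : l A = (l A - u N A) + u N A by rewrite subrK.
  apply: le_trans (rdotD_le _ _) _; apply: lerD; last by rewrite ler_pM2l.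
  rewrite ler_pM2l // -hnorm2 hnormB; have := NP N (leqnn N) A => /ltW h.
  by rewrite expr_le1 // hnorm_ge0.
pose L : M := Fam perfK lc lb.
exists L => e e0; have e2 : 0 < e / 2 by rewrite divr_gt0.
have [N NP] := ul _ e2; exists N => n Nn.
rewrite /dot_norm -[ltRHS]gtr0_norm // -sqrtr_sqr ltr_sqrt ?exprn_gt0 //.
apply: le_lt_trans (_ : (e / 2) ^+ 2 < _).
  apply: fnorm_le => A; rewrite -hnorm2 fxB.
  by rewrite ler_pXn2r ?nnegrE ?hnorm_ge0 ?ltW //; apply: NP.
by rewrite ltr_pXn2r ?nnegrE ?ltW //; lra.
Qed.

Definition modelH : hilbert R := Hilbert fam_complete.

End Families.

(** * The action of K on compatible families *)

Section ModelRep.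
Variables (R : realType) (Omega : Type) (K : subgroup Omega).
Hypothesis perfK : perfect_oligomorphic K.
Variable T : srep R K.
Implicit Types (A B C : perfset K) (g h k : K).

Local Notation S A := (ospace T (A : Tra K)).
Local Notation Tm := (Tm T).
Local Notation M := (modelH perfK T).
Local Notation F := (fam T perfK).
Implicit Types x y z : F.
Local Notation rd x y := (rdot (x : M) (y : M)).
Local Notation hn x := (hnorm (x : M)).

#[local] Obligation Tactic := idtac.

Program Definition iota A (u : S A) : F := @Fam R Omega K T perfK (fun B => Tm 1%g A B u) _ _.
Next Obligation. by move=> A u B C BC /=; apply: Tm_comp => // x Ax /BC. Qed.
Next Obligation. by move=> A u; exists (rdot u u) => B; apply: Tm1_contr. Qed.

Lemma iotaB A (u v : S A) : iota (u - v) = iota u - iota v.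
Proof. by apply: famP => B; rewrite fxB /= linearB. Qed.

Lemma iotaK A (u : S A) : iota u A = u. Proof. exact: Tm1. Qed.

(** [iota] is adjoint to evaluation at [A]: the inner products of components are constant as soon as
    [B] contains [A]. *)
Lemma hdot_iota x A (u : S A) : hdot (x : M) (iota u : M) = hdot (x A) u.
Proof.
have E B : A `<=` B -> hdot (x B) (iota u B) = hdot (x A) u.
  by move=> AB; rewrite -(fcompat x AB) Tm1_adj.
by apply: famdot_uniq; apply: ucvg_eq _ (ucvg_cst _);
  apply: filterS (cofUP perfK A) => B AB /=; rewrite E.
Qed.

Lemma rdot_iota x A (u : S A) : rd x (iota u) = rdot (x A) u.
Proof. by rewrite /rdot hdot_iota. Qed.

Lemma hnorm_iota A (u : S A) : hn (iota u) = hnorm u.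
Proof. by rewrite /hnorm /dot_norm -!/(rdot _ _) rdot_iota iotaK. Qed.

Lemma hnorm_comp x A : hnorm (x A) <= hn x.
Proof. by rewrite hnorm_le ?hnorm_ge0 // hnorm2 fnorm_ge. Qed.

Lemma fam_approx x (e : R) : 0 < e -> exists A, forall B, A `<=` B ->
  rd x x - e < rdot (x B) (x B).
Proof.
move=> e0; have [A xA] := filter_ex (cRe x x e0).
exists A => B AB; apply: lt_le_trans (fnorm_mono x AB).
have : `|rdot (x A) (x A) - rd x x| < e := xA.
by rewrite ltr_norml => /andP[]; lra.
Qed.

(** [iota (x B)] is the projection of [x] onto the copy of T(B), at squared distance
    [<x, x> - <x B, x B>], which tends to 0. Thus the copies of the T(B) span a dense subspace. *)
Lemma iota_approx x (e : R) : 0 < e -> exists A, forall B, A `<=` B ->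
  hn (x - iota (x B)) < e.
Proof.
move=> e0; have [A AP] := fam_approx x (exprn_gt0 2 e0).
exists A => B /AP xB; rewrite hnorm_lt ?ltW //.
rewrite !(rdotBl, rdotBr) (rdotC (iota (x B) : M) (x : M)) !rdot_iota iotaK.
by move: xB; lra.
Qed.

Program Definition ract g x : F :=
  @Fam R Omega K T perfK (fun A => Tm g (preimP g A) A (x (preimP g A))) _ _.
Next Obligation.
move=> g x A B AB /=.
have AB' : preimP g A `<=` preimP g B by move=> w /AB.
rewrite -(fcompat x AB') (@Tm_comp _ _ _ _ _ _ g); [|by []|by move=> w Bw /AB].
symmetry; exact: Tm_comp.
Qed.
Next Obligation.
move=> g x; have [m mP] := fbound x; exists m => A.
by rewrite /rdot Tm_iso //; apply: mP.
Qed.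

Lemma ractE g x A B : preimP g A `<=` B -> ract g x A = Tm g B A (x B).
Proof. by move=> AB /=; rewrite -(fcompat x AB); apply: Tm_comp => // w Bw Aw; split=> //; apply: AB. Qed.

Lemma ract_lin g : linear (ract g : M -> M).
Proof. by move=> a x y; apply: famP => A /=; rewrite linearP. Qed.

Lemma ract1 x : ract 1%g x = x.
Proof.
by apply: famP => A; rewrite (@ractE _ _ A A) ?Tm1 // => w.
Qed.

Lemma ractM g h x : ract (g * h)%g x = ract g (ract h x).
Proof.
apply: famP => A /=; rewrite -/(ract h x).
rewrite (@Tm_comp _ _ _ _ _ _ (g * h)%g) //; apply: ractE.
by move=> w.
Qed.

Lemma ract_norm g x : rd (ract g x) (ract g x) = rd x x.
Proof.
have le h z : rd (ract h z) (ract h z) <= rd z z.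
  by apply: fnorm_le => A; rewrite /= /rdot Tm_iso //; exact: fnorm_ge.
apply/eqP; rewrite eq_le le /=.
by have := le g^-1%g (ract g x); rewrite -ractM mulVg ract1.
Qed.

Lemma ract_unitary g : unitary_op (ract g : M -> M).
Proof.
split; first exact: ract_lin.
  by apply: hdot_isometry; [exact: ract_lin|exact: ract_norm].
by move=> y; exists (ract g^-1%g y); rewrite -ractM mulgV ract1.
Qed.

Lemma ract_iota g A (u : S A) C : ract g (iota u) C = Tm g A C u.
Proof. by rewrite /=; apply: Tm_comp. Qed.

Lemma hnorm_ract g x : hn (ract g x) = hn x.
Proof. by rewrite /hnorm /dot_norm -!/(rdot _ _) ract_norm. Qed.

Lemma ractB g x y : ract g (x - y) = ract g x - ract g y.
Proof. by rewrite addrC -scaleN1r ract_lin scaleN1r addrC. Qed.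

(** On the copy of T(A) the action of [g] depends only on [g] restricted to [A]; density and
    isometry do the rest. *)
Lemma ract_cont x g (e : R) : 0 < e ->
  \forall h \near g, hn (ract h x - ract g x) < e.
Proof.
move=> e0; have e2 : 0 < e / 2 by rewrite divr_gt0.
have [A /(_ A (fun=> id)) xA] := iota_approx x e2.
have [fA _] := psetP A.
apply: filterS (nbhs_agree g fA) => h hg.
set i := iota (x A) in xA.
have hi : ract h i = ract g i.
  by apply: famP => C; rewrite !ract_iota; apply: Tm_eq => w Aw _; apply: hg.
apply: le_lt_trans (hnormBD _ (ract h i : M) _) _.
rewrite -ractB hnorm_ract hi -ractB hnorm_ract (hnormB (i : M)).
by lra.
Qed.

Hypothesis countableOmega : ([set: Omega] #= [set: nat])%card.

(** Countability of [Omega] enters here, to make the model separable. *)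
Lemma cofinal_seq : exists A : nat -> perfset K, forall B, exists n, B `<=` A n.
Proof.
have /card_eqP/unsquash f := countableOmega.
pose c (w : Omega) : nat := val (f (to_setT w)).
have cinj : injective c.
  move=> v w /val_inj vw.
  by have /(congr1 val) := @inj _ _ _ f _ _ (in_setT _) (in_setT _) vw.
have fin n : finite_set [set w | (c w < n)%N].
  apply: (@finite_preimage _ _ [set k | (k < n)%N] c); last exact: finite_II.
  by move=> v w _ _; apply: cinj.
have [A AP] := choice (fun n => perfect_sup perfK (fin n)).
exists A => B; have [fB _] := psetP B.
have [s sB] := (finite_seqP (pset B : set {classic Omega})).1 fB.
exists (\max_(w <- s) c w).+1 => w; rewrite sB => ws; apply: AP => /=.
by rewrite ltnS; apply: leq_bigmax_seq.
Qed.

Lemma model_separable : hseparable M.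
Proof.
have [An AnP] := cofinal_seq.
have [[sep _] _ _ _] := srP T.
pose s A := sval (cid (sep A)).
have sP A (u : S A) (e : R) : 0 < e -> exists n, hnorm (u - s A n) < e.
  by rewrite /s; case: cid => /= ? H; exact: H.
exists (fun n => let p := odflt (0, 0)%N (unpickle n) in iota (s (An p.1) p.2)) => x e e0.
have e2 : 0 < e / 2 by rewrite divr_gt0.
have [A AP] := iota_approx x e2; have [n An_] := AnP A.
have xn := AP _ An_; have [m mP] := sP _ (x (An n)) _ e2.
exists (pickle (n, m)); rewrite pickleK /=.
apply: le_lt_trans (hnormBD _ (iota (x (An n)) : M) _) _.
have -> : hnorm ((iota (x (An n)) : M) - (iota (s (An n) m) : M)) = hnorm (x (An n) - s (An n) m).
  by rewrite -hnorm_iota iotaB.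
by lra.
Qed.

Definition model : urep R K :=
  @URep R Omega K M ract ract_unitary ract1 ractM ract_cont model_separable.

(** Take a large [B] containing [A] and, by [neumann], [k] in K(A) moving [B] minus [A] off [B].
    Then [k] restricted from [B] to [B] is the identity of [A], so [k (iota (x B))] and [iota (x A)]
    have the same component at [B]. Since [k x = x], the component of [x - iota (x A)] at [B] is
    that of [k (x - iota (x B))], which is small. *)
Lemma model_fixed A (x : F) : fixed_set model A x -> x = iota (x A).
Proof.
move=> xA; apply/eqP; rewrite -subr_eq0; apply/eqP.
set y : F := x - iota (x A).
apply: (@hnorm_small R M) => e e0.
have e2 : 0 < e / 2 by rewrite divr_gt0.
have [A1 A1P] := iota_approx x e2.
(* The squared norm of [y] is then below [(e / 2) ^+ 2 + e ^+ 2 / 2]. *)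
have [|A2 A2P] := @fam_approx y (e ^+ 2 / 2); first by rewrite divr_gt0 ?exprn_gt0.
have [A3 [A13 A23]] := perfset_sup perfK A1 A2.
have [B [A3B AB]] := perfset_sup perfK A3 A.
have {A1P}xB := A1P B (subset_trans A13 A3B).
have {A2P}yB := A2P B (subset_trans A23 A3B).
have [fB _] := psetP B.
have [|k kA kB] := neumann (psetP A) (finite_setD _ fB : finite_set (pset B `\` A)) _ fB.
  by move=> w [].
have yBE : y B = (x - ract k (iota (x B))) B.
  rewrite /y !fxB; congr (_ - _); rewrite ract_iota /= -(fcompat x AB).
  apply: Tm_comp => [w Bw Aw _|w Bw kw]; first exact: kA.
  have Aw : pset A w by apply: contrapT => nAw; apply: (kB w).
  by split=> //; apply: kA.
have h : hnorm (y B) < e / 2.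
  rewrite yBE; apply: le_lt_trans (hnorm_comp _ _) _.
  by rewrite -{1}(xA k kA) -[rho_of _ _ _]/(ract k x) -ractB hnorm_ract.
rewrite hnorm_lt ?ltW //.
have h2 : rdot (y B) (y B) < (e / 2) ^+ 2 by rewrite -hnorm_lt // ltW.
have : 0 < e ^+ 2 by rewrite exprn_gt0.
by move: h2; rewrite exprMn; move: yB; lra.
Qed.

Lemma tilde_model : star_rep_equiv (tilde model) T.
Proof.
have fixE A (v : cs_hilbert (fixed_space model A)) : val v = iota ((val v : F) A) :> F.
  by apply: model_fixed; exact: cs_fixed.
have iota_fix A (u : S A) : fixed_set model A (iota u).
  move=> g gA; apply: famP => C; rewrite -[LHS]/(ract g (iota u) C) ract_iota.
  by apply: Tm_eq => w Aw _; apply: gA.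
exists (fun (A : Tra K) (v : cs_hilbert (fixed_space model A)) => (val v : F) A).
split=> [A|B A p v].
  split=> [a u v//|u v|u]; last first.
    by exists (exist _ (iota u : M) (mem_set (@iota_fix A u))); exact: iotaK.
  rewrite -[RHS]/(hdot (val u : M) (val v : M)) (fixE A v) hdot_iota.
  by rewrite -(fixE A v).
set g := sval (cid (tpbP p)).
have gE : p = tra_restr g B A by apply: trahomP; exact: trahom_rep.
have PA (y : F) : (fproj model A y : F) A = y A.
  have yE : fproj model A y = iota (y A).
    apply: P_uniq; first exact: iota_fix.
    move=> s As; rewrite (model_fixed As).
    by rewrite -[LHS]/(rd (iota (y A)) (iota (s A))) -[RHS]/(rd y (iota (s A))) !rdot_iota iotaK.
  by rewrite yE iotaK.
rewrite {1}gE -[LHS]/(Tm g B A ((val v : F) B)).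
rewrite -[RHS]/((fproj model A (ract g (val v)) : F) A) PA.
by rewrite [in RHS](fixE B v) ract_iota.
Qed.

End ModelRep.

(** * Recovering a unitary representation from its *-representation *)

Section Density.
Variables (R : realType) (Omega : Type) (K : subgroup Omega) (rho : urep R K).
Hypothesis perfK : perfect_oligomorphic K.
Local Notation L := (rspace rho).
Local Notation "g • v" := (rho_of rho g v) (at level 40, v at level 40).

(* The element of minimal norm of a K(A)-invariant closed convex set avoiding 0
   is a nonzero K(A)-fixed vector. *)
Lemma fproj_eq0 (u : L) : (forall A : perfset K, fproj rho A u = 0) -> u = 0.
Proof.
move=> Pu; apply/eqP; apply: contrapT => /negP u0.
have uu : 0 < rdot u u by rewrite lt_def rdot_eq0 u0 rdot_ge0.
have [|X fX XP] := nbhsP_agree (rho_continuous u (1 : K)%g (e := hnorm u) _).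
  by rewrite lt_def hnorm_eq0 u0 hnorm_ge0.
have [A XA] := perfect_sup perfK fX.
(* A half-space made K(A)-invariant. It contains [u]: K(A) moves [u] by less than its norm, and this
   means [<g u, u> > <u, u> / 2]. *)
pose C := [set x : L | forall g : K, fixer A g -> rdot u u / 2 <= rdot (g • x) u].
have Cu : C u.
  move=> g gA; have : hnorm (g • u - 1%g • u) < hnorm u.
    by apply: XP => w /XA Aw; rewrite /= gA.
  rewrite rho1 hnorm_lt ?hnorm_ge0 // hnorm2 !(rdotBl, rdotBr) rho_rdot (rdotC u (g • u)).
  by move=> ?; lra.
have Cc : hclosed C.
  move=> s l sC sl g gA; rewrite leNgt; apply/negP => lt.
  have d0 : 0 < rdot u u / 2 - rdot (g • l) u by rewrite subr_gt0.
  have hu : 0 < hnorm u by rewrite lt_def hnorm_eq0 u0 hnorm_ge0.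
  have [N /(_ N (leqnn N))] := sl _ (divr_gt0 d0 hu).
  rewrite -/(hnorm _) -(hnorm_rho g) linearB /= ltr_pdivlMr // => h.
  have := rdot_CS (g • s N - g • l) u; rewrite ler_norml => /andP[_].
  by rewrite rdotBl; have := sC N g gA; move: h; lra.
have Cv : rconvex C.
  move=> x y Cx Cy g gA; rewrite linearZ /= linearD rdotZl rdotDl.
  by have := Cx g gA; have := Cy g gA; lra.
have phi0 (x : L) : (0 : R) <= 0 * hnorm x by rewrite mul0r.
have phiZ0 (a : R) (x : L) : (0 : R) = a * 0 by rewrite mulr0.
have phiD0 (x y : L) : (0 : R) = 0 + 0 by rewrite addr0.
have [m Cm mmin] := @quadratic_min R L (fun=> 0) 0 C phiD0 phiZ0 phi0 (ex_intro _ u Cu) Cc Cv.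
have mA : fixed_set rho A m.
  move=> g gA; symmetry.
  apply: (@quadratic_min_unique R L (fun=> 0) C phiD0 phiZ0 Cv) => //.
    by move=> h hA; rewrite -rhoM; apply: Cm; apply: fixerM.
  by rewrite rho_rdot.
(* As [m] is fixed, [<m, u>] equals [<m, P_A u> = 0], yet it is at least [<u, u> / 2]. *)
have := Cm 1%g (fun _ _ => erefl); rewrite rho1 (rdotC m) -(P_rdotl u mA) Pu rdot0l.
by rewrite leNgt divr_gt0.
Qed.

Lemma fproj_ext (u v : L) :
  (forall A : perfset K, fproj rho A u = fproj rho A v) -> u = v.
Proof.
move=> uv; apply/eqP; rewrite -subr_eq0; apply/eqP/fproj_eq0 => A.
by rewrite linearB /= uv subrr.
Qed.

End Density.

Section Equivalence.
Variables (R : realType) (Omega : Type) (K : subgroup Omega).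
Hypothesis countableOmega : ([set: Omega] #= [set: nat])%card.
Hypothesis perfK : perfect_oligomorphic K.
Implicit Types rho : urep R K.

Definition tilde_srep rho : srep R K := SRep (tilde_star_rep perfK rho).
Local Notation model T := (model perfK T countableOmega).

Lemma urep_equiv_sym rho rho' : urep_equiv rho rho' -> urep_equiv rho' rho.
Proof.
move=> [U [[Ulin Uiso Usurj] Urho]]; have [V VK] := choice Usurj.
have UB x y : U (x - y) = U x - U y by rewrite addrC -scaleN1r Ulin scaleN1r addrC.
have Uinj : injective U.
  move=> x y xy; apply/eqP; rewrite -subr_eq0 -rdot_eq0 /rdot -Uiso.
  by rewrite UB xy subrr linear0.
exists V; split; first split.
- by move=> a x y; apply: Uinj; rewrite Ulin !VK.
- by move=> x y; rewrite -Uiso !VK.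
- by move=> y; exists (U y); apply: Uinj; rewrite VK.
- by move=> g v; apply: Uinj; rewrite Urho !VK.
Qed.

Lemma urep_equiv_trans rho1 rho2 rho3 :
  urep_equiv rho1 rho2 -> urep_equiv rho2 rho3 -> urep_equiv rho1 rho3.
Proof.
move=> [U [[Ulin Uiso Usurj] Urho]] [V [[Vlin Viso Vsurj] Vrho]].
exists (V \o U); split; first split.
- by move=> a x y /=; rewrite Ulin Vlin.
- by move=> x y /=; rewrite Viso Uiso.
- by move=> z; have [y <-] := Vsurj z; have [x <-] := Usurj y; exists x.
- by move=> g v /=; rewrite Urho Vrho.
Qed.

Lemma model_functorial (T T' : srep R K) :
  star_rep_equiv T T' -> urep_equiv (model T) (model T').
Proof.
move=> [U [Uu UT]].
have Ulin A : linear (U A) by case: (Uu A).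
have Uiso A x y : hdot (U A x) (U A y) = hdot x y by case: (Uu A).
have Usurj A y : exists x, U A x = y by case: (Uu A).
have VP A y : {x | U A x = y} by apply: cid.
pose V A y := sval (VP A y).
have UV A y : U A (V A y) = y by rewrite /V; case: (VP A y).
have UB A x y : U A (x - y) = U A x - U A y.
  by rewrite addrC -scaleN1r Ulin scaleN1r addrC.
have Uinj A : injective (U A).
  move=> x y xy; apply/eqP; rewrite -subr_eq0 -rdot_eq0 /rdot -Uiso.
  by rewrite UB xy subrr linear0.
have Uc (x : fam T perfK) (A B : perfset K) : A `<=` B ->
    Tm T' 1%g B A (U B (x B)) = U A (x A).
  by move=> AB; rewrite /Tm UT -(fcompat x AB).
have Ub (x : fam T perfK) : exists m, forall A : perfset K, rdot (U A (x A)) (U A (x A)) <= m.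
  by have [m mP] := fbound x; exists m => A; rewrite /rdot Uiso; exact: mP.
pose W (x : fam T perfK) : fam T' perfK := Fam perfK (Uc x) (Ub x).
exists W; split; first split.
- by move=> a x y; apply: famP => A; rewrite fxP /= Ulin.
- move=> x y; apply: famdot_uniq; apply: ucvg_eq.
  + by apply: filterS filterT => A _ /=; rewrite Uiso.
  + exact: cRe.
  + by apply: filterS filterT => A _ /=; rewrite Uiso.
  + exact: cIm.
- move=> y.
  have Vc (A B : perfset K) : A `<=` B -> Tm T 1%g B A (V B (y B)) = V A (y A).
    move=> AB; apply: Uinj; rewrite UV -(fcompat y AB) -{2}(UV B (y B)).
    by rewrite /Tm UT.
  have Vb : exists m, forall A : perfset K, rdot (V A (y A)) (V A (y A)) <= m.
    by have [m mP] := fbound y; exists m => A; rewrite /rdot -Uiso UV; exact: mP.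
  by exists (Fam perfK Vc Vb); apply: famP => A /=; rewrite UV.
- by move=> g x; apply: famP => A /=; rewrite /Tm UT.
Qed.

(** [J] sends [v] to the family of its projections P_A v and is a contraction. Its adjoint, obtained
    from Riesz in [adj], sends [x] to some [y] with [P_A y = x A] for all [A]. This gives
    surjectivity at once, and with [x = J v] density forces [y = v], so [J] is isometric. *)
Lemma urep_equiv_model rho : urep_equiv rho (model (tilde_srep rho)).
Proof.
pose T := tilde_srep rho.
have TmE g (A B : perfset K) v : Tm T g A B v = tilde_op rho B A g v.
  by rewrite -(oper_tilde perfK).
pose pr (A : perfset K) (v : rspace rho) := orthoproj (fixed_space rho A) v.
have Jc (v : rspace rho) (A B : perfset K) : A `<=` B -> Tm T 1%g B A (pr B v) = pr A v.
  move=> AB; rewrite TmE; apply: val_inj.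
  by rewrite val_tilde_op rho1 -[val (pr B v)]/(fproj rho B v) P_sub.
have Jb (v : rspace rho) : exists m, forall A : perfset K, rdot (pr A v) (pr A v) <= m.
  by exists (rdot v v) => A; exact: (proj_norm_le (fixed_space rho A) v).
pose J (v : rspace rho) : fam T perfK := Fam perfK (Jc v) (Jb v).
have JE v A : val (J v A) = fproj rho A v by [].
have Jlin : linear (J : rspace rho -> modelH perfK T).
  move=> a x y; apply: famP => A; apply: val_inj; rewrite fxP JE.
  transitivity (a *: fproj rho A x + fproj rho A y); last by [].
  by rewrite -(proj_linear (fixed_space rho A)).
have JD x y : J (x + y) = J x + J y by have := Jlin 1 x y; rewrite !scale1r.
have JZ a x : J (rc a *: x) = rc a *: J x.
  have := Jlin (rc a) x 0; rewrite addr0 => ->.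
  have J0 : J 0 = 0 by apply: famP => A; apply: val_inj; rewrite JE linear0.
  by rewrite J0 addr0.
have Jle v : rdot (J v : modelH perfK T) (J v : modelH perfK T) <= rdot v v.
  by apply: fnorm_le => A; exact: (proj_norm_le (fixed_space rho A) v).
have JA A (v : cs_hilbert (fixed_space rho A)) : J (val v) = @iota R Omega K perfK T A v.
  apply: famP => B; apply: val_inj; rewrite JE /= TmE val_tilde_op rho1 //.
have adj (x : fam T perfK) : exists y, (forall A, fproj rho A y = val (x A)) /\
    forall v, rdot (J v : modelH perfK T) (x : modelH perfK T) = rdot v y.
  have [|||y yP] := @riesz R (rspace rho)
     (fun v => rdot (J v : modelH perfK T) (x : modelH perfK T)) (hnorm (x : modelH perfK T)).
  - by move=> u v; rewrite JD rdotDl.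
  - by move=> a u; rewrite JZ rdotZl.
  - move=> u; apply: le_trans (ler_norm _) _; apply: le_trans (rdot_CS _ _) _.
    rewrite mulrC ler_wpM2l ?hnorm_ge0 // hnorm_le ?hnorm_ge0 // hnorm2; exact: Jle.
  exists y; split=> // A; apply: P_uniq; first exact: cs_fixed.
  move=> s sA; rewrite (rdotC y) -yP.
  have -> : J s = @iota R Omega K perfK T A (exist _ s (mem_set sA)) by rewrite -JA.
  by rewrite [RHS]rdotC [RHS]rdot_iota.
exists J; split; first split.
- exact: Jlin.
- apply: hdot_isometry => // v.
  have [y [yP Jy]] := adj (J v).
  by rewrite Jy; congr rdot; apply: (fproj_ext perfK) => A; rewrite yP.
- move=> x; have [y [yP _]] := adj x; exists y; apply: famP => A; apply: val_inj.
  by rewrite JE yP.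
- move=> g v; apply: famP => A; apply: val_inj; rewrite JE /= TmE val_tilde_op.
  rewrite P_rho -[val _]/(fproj rho (preimP g A) v) P_rho.
  by rewrite (P_id (@P_in _ _ _ rho (preimP g A) v)).
Qed.

End Equivalence.

(** * The linearization of Tra(K) *)

Section FiniteDim.
Variables (R : realType) (n : nat).
Local Notation V := 'rV[cplx R]_n.
Local Notation Re := (@complex.Re R).
Local Notation Im := (@complex.Im R).
Local Notation q z := (Re (dotmx z z)).

Lemma dotmx_sum (z : V) : q z = \sum_j (Re (z 0 j) ^+ 2 + Im (z 0 j) ^+ 2).
Proof.
rewrite dotmxE mxE.
have ReS (F : 'I_n -> cplx R) : Re (\sum_j F j) = \sum_j Re (F j).
  by apply: (big_morph Re (ReD (R:=R))).
rewrite ReS; apply: eq_bigr => j _; rewrite !mxE.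
by case: (z 0 j) => a b /=; ring.
Qed.

Lemma dotmx_coord (z : V) j : Re (z 0 j) ^+ 2 <= q z /\ Im (z 0 j) ^+ 2 <= q z.
Proof.
have h : Re (z 0 j) ^+ 2 + Im (z 0 j) ^+ 2 <= q z.
  rewrite dotmx_sum (bigD1 j) //= lerDl sumr_ge0 // => i _.
  by rewrite addr_ge0 ?sqr_ge0.
by split; apply: le_trans h; rewrite ?lerDl ?lerDr sqr_ge0.
Qed.

Lemma dotmx_bound (z : V) (e : R) :
  (forall j, `|Re (z 0 j)| <= e /\ `|Im (z 0 j)| <= e) -> q z <= (e ^+ 2 *+ 2) *+ n.
Proof.
move=> ze; rewrite dotmx_sum -[in leRHS](card_ord n) -sumr_const.
apply: ler_sum => j _; have [h1 h2] := ze j; rewrite mulr2n.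
have e0 : 0 <= e by apply: le_trans h1.
by rewrite lerD // -real_normK ?num_real // ler_pXn2r ?nnegrE.
Qed.

Lemma dotmx_lt (e : R) : 0 < e -> exists2 d : R, 0 < d &
  forall z : V, (forall j, `|Re (z 0 j)| <= d /\ `|Im (z 0 j)| <= d) ->
  dot_norm (@dotmx (cplx R) n) z < e.
Proof.
(* Coordinates bounded by [e / N] give squared norm at most [2 n e ^+ 2 / N ^+ 2], and
   [2 n < N <= N ^+ 2]. *)
move=> e0; pose N : R := (n.*2.+1)%:R.
have N0 : 0 < N by rewrite ltr0n.
exists (e / N); first by rewrite divr_gt0.
move=> z /dotmx_bound h; rewrite /dot_norm -[ltRHS]gtr0_norm // -sqrtr_sqr.
rewrite ltr_sqrt ?exprn_gt0 //; apply: le_lt_trans h _.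
rewrite -mulrnA mul2n exprMn -mulr_natr -mulrA -ltr_pdivlMl ?exprn_gt0 //.
rewrite mulVf ?expf_neq0 ?gt_eqF // exprVn mulrC ltr_pdivrMr ?exprn_gt0 // mul1r.
have h1 : (n.*2)%:R < N :> R by rewrite ltr_nat.
apply: lt_le_trans h1 _; rewrite expr2 ler_pMr // ler1n //.
Qed.

Lemma ucvg_near (I : Type) (U : set_system I) {UU : UltraFilter U} (f : I -> R) l c e :
  ucvg U f l -> U [set i | `|f i - c| <= e] -> `|c - l| <= e.
Proof.
move=> fl fc; rewrite ler_norml; apply/andP; split.
  rewrite -subr_ge0.
  have : l <= c + e; last by lra.
  apply: ucvg_le fl (ucvg_cst _) _; apply: filterS fc => i /=.
  by rewrite ler_norml => /andP[]; lra.
have : c - e <= l; last by lra.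
apply: ucvg_le (ucvg_cst _) fl _; apply: filterS fc => i /=.
by rewrite ler_norml => /andP[]; lra.
Qed.

Lemma rv_complete (u : nat -> V) : dot_cauchy (@dotmx (cplx R) n) u ->
  exists l, dot_cvg (@dotmx (cplx R) n) u l.
Proof.
move=> cu; have [U UU oU] := ultra_eventually.
have main (p : cplx R -> R) : (forall a b, p (a - b) = p a - p b) ->
    (forall (z : V) j, p (z 0 j) ^+ 2 <= q z) ->
    exists l : 'I_n -> R, forall e : R, 0 < e -> exists N, forall k, (N <= k)%N ->
      forall j, `|p (u k 0 j) - l j| <= e.
  move=> pB pq.
  have cp (e : R) : 0 < e -> exists N, forall k m, (N <= k)%N -> (N <= m)%N ->
      forall j, `|p (u k 0 j) - p (u m 0 j)| <= e.
    move=> e0; have [N NP] := cu e e0; exists N => k m Nk Nm j.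
    have := NP k m Nk Nm; rewrite /dot_norm -[ltRHS]gtr0_norm // -sqrtr_sqr.
    rewrite ltr_sqrt ?exprn_gt0 // => /ltW h.
    have := le_trans (pq (u k - u m) j) h; rewrite !mxE pB.
    by rewrite -[in X in X -> _]real_normK ?num_real // ler_pXn2r ?nnegrE // ltW.
  have [N1 N1P] := cp 1 ltr01.
  (* Cutting off the indices below [N1] makes the sequence bounded without changing its tail. *)
  pose f j k := p (u (maxn N1 k) 0 j).
  have bf j : bfun (f j).
    exists (`|p (u N1 0 j)| + 1) => k.
    have -> : f j k = p (u N1 0 j) + (f j k - p (u N1 0 j)) by rewrite addrC subrK.
    by apply: le_trans (ler_normD _ _) _; rewrite lerD2l; apply: N1P => //; exact: leq_maxl.
  exists (fun j => ulim U (f j)) => e e0; have [N NP] := cp e e0.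
  exists N => k Nk j; apply: (ucvg_near (ulimP (bf j))).
  apply: oU; exists N => // m /= Nm; rewrite /f.
  by apply: NP => //; apply: leq_trans Nm _; exact: leq_maxr.
have [|z j|lr lrP] := main Re; first by move=> [a b] [c d].
  by have [] := dotmx_coord z j.
have [|z j|li liP] := main Im; first by move=> [a b] [c d].
  by have [] := dotmx_coord z j.
exists (\row_j Complex (lr j) (li j)) => e e0.
have [d d0 dP] := dotmx_lt e0.
have [N1 N1P] := lrP d d0; have [N2 N2P] := liP d d0.
exists (maxn N1 N2) => k; rewrite geq_max => /andP[Nk1 Nk2]; apply: dP => j.
rewrite !mxE; have := N1P k Nk1 j; have := N2P k Nk2 j.
by case: (u k 0 j) => a b /=.
Qed.

Definition rvH : hilbert R := Hilbert rv_complete.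

Lemma rv_separable : hseparable rvH.
Proof.
pose emb (r : 'rV[rat * rat]_n) : V := \row_j Complex (ratr (r 0 j).1) (ratr (r 0 j).2).
exists (fun m => if unpickle m is Some r then emb r else 0) => x e e0.
have [d d0 dP] := dotmx_lt e0.
have dense (a : R) : {r : rat | `|a - ratr r| <= d}.
  have h : a - d < a + d by lra.
  apply: cid; have [r] := rat_in_itvoo h; rewrite in_itv /= => /andP[h1 h2].
  by exists r; rewrite ler_norml; apply/andP; split; lra.
pose r : 'rV[rat * rat]_n := \row_j (sval (dense (Re (x 0 j))), sval (dense (Im (x 0 j)))).
exists (pickle r); rewrite pickleK; apply: dP => j; rewrite !mxE /=.
case: (x 0 j) => a b /=.
by case: (dense a) => ra /= ?; case: (dense b) => rb /= ?.
Qed.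

End FiniteDim.

(** * Partial bijections as matrices of zeros and ones *)

Section Linearization.
Variables (R : realType) (Omega : Type) (K : subgroup Omega).
Implicit Types A B C : perfset K.

Lemma perfset_enum A : {s : seq {classic Omega} | uniq s /\ (A : set Omega) = [set` s]}.
Proof.
apply: cid; have [fA _] := psetP A.
have [s ->] := (finite_seqP (pset A : set {classic Omega})).1 fA.
exists (undup s); split; first exact: undup_uniq.
by apply/seteqP; split=> x /=; rewrite mem_undup.
Qed.

Definition pseq A := sval (perfset_enum A).
Definition dimA A := size (pseq A).
Definition pt A (i : 'I_(dimA A)) : Omega := tnth (in_tuple (pseq A)) i.

Lemma pseqP A : uniq (pseq A) /\ (A : set Omega) = [set` pseq A].
Proof. by rewrite /pseq; case: perfset_enum. Qed.

Lemma pt_in A i : pset A (@pt A i).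
Proof. by rewrite (pseqP A).2; exact: mem_tnth. Qed.
Lemma pt_surj A w : pset A w -> exists i, @pt A i = w.
Proof. by rewrite {1}(pseqP A).2 => /(tnthP (in_tuple (pseq A)))[i ->]; exists i. Qed.
Lemma pt_inj A : injective (@pt A).
Proof. by apply/(tuple_uniqP (in_tuple (pseq A))); case: (pseqP A). Qed.

Definition pmx A B (m : pbij A B) : 'M[cplx R]_(dimA A, dimA B) :=
  \matrix_(i, j) (`[< graph m (pt i) (pt j) >])%:R.

Lemma pmx_comp A B C (m : pbij A B) (l : pbij B C) : pmx m *m pmx l = pmx (pb_comp l m).
Proof.
apply/matrixP => i k; rewrite !mxE.
have [[y my ly]|nE] := pselect (graph (pb_comp l m) (pt i) (pt k)).
  have [_ By] := graph_sub my; have [j jy] := pt_surj By.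
  rewrite (bigD1 j) //= big1 ?addr0.
    by rewrite !mxE jy !asboolT ?mulr1 //; exists y.
  move=> j' jj'; rewrite !mxE asboolF ?mul0r // => mj'; case/eqP: jj'.
  by apply: pt_inj; rewrite jy; exact: (graph_fun mj' my).
rewrite [in RHS]asboolF // big1 // => j _; rewrite !mxE.
case: asboolP => [mj|_]; last by rewrite mul0r.
by case: asboolP => [lj|_]; [case: nE; exists (pt j)|rewrite mulr0].
Qed.

Lemma pmx_id A : pmx (pb_id A) = 1%:M.
Proof.
apply/matrixP => i j; rewrite !mxE; congr (_%:R); congr nat_of_bool.
apply/asboolP/eqP => [[_ /pt_inj]//|->]; split=> //; exact: pt_in.
Qed.

Lemma pmx_adj A B (m : pbij A B) u v :
  dotmx (u *m pmx m) v = dotmx u (v *m pmx (pb_star m)).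
Proof.
rewrite !dotmxE trmx_mul map_mxM -!mulmxA; congr ((u *m _) 0 0); congr (_ *m _).
by apply/matrixP => i j; rewrite !mxE rmorph_nat.
Qed.

Definition lin_op : opsys R (Tra K) :=
  @OpSys R (Tra K) (fun A => rvH R (dimA A)) (fun A B (m : trahom A B) v => v *m pmx m).

Lemma lin_star_rep : star_rep lin_op.
Proof.
have opc A B C (p : @mor (Tra K) A B) (q : @mor (Tra K) B C) v :
    oper lin_op q (oper lin_op p v) = oper lin_op (mcomp q p) v.
  by rewrite /= -mulmxA pmx_comp.
have opa A B (p : @mor (Tra K) A B) : adjoint_op (oper lin_op p) (oper lin_op (mstar p)).
  by move=> u v; exact: pmx_adj.
split=> //; last by move=> A v; rewrite /= pmx_id mulmx1.
split=> [A|A B p]; first exact: rv_separable.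
split; first by move=> a u v /=; rewrite mulmxDl scalemxAl.
exists 1 => x; rewrite mul1r hnorm_le ?hnorm_ge0 // hnorm2.
(* [e] is the identity of the domain of [p], a self-adjoint idempotent; so
   [<p x, p x> = <x, e x> = <e x, e x>], which bounds it by [<x, x>]. *)
pose e := mcomp (mstar p) p; set y := oper lin_op e x.
have h1 : rdot (oper lin_op p x) (oper lin_op p x) = rdot x y by rewrite /rdot opa opc.
have ee : mcomp e e = e.
  apply/trahomP/pbijP => i j; split=> /=.
    by case=> k [l il kl] [l' kl' jl']; exists l => //; move: jl'; rewrite -(graph_fun kl kl').
  by case=> l il jl; exists i; exists l.
have es : mstar e = e by rewrite /e mstarM mstarK.
have h2 : rdot y y = rdot x y by rewrite {1 2}/y /rdot opa es opc ee.
by rewrite h1; have := rdot_ge0 (x - y); rewrite !(rdotBl, rdotBr) (rdotC y x) h2; lra.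
Qed.

Definition lin_srep : srep R K := SRep lin_star_rep.

Lemma lin_faithful A B (p q : @mor (Tra K) A B) :
  (forall v, oper lin_op p v = oper lin_op q v) -> p = q.
Proof.
move=> pq; apply/trahomP/pbijP.
have E (i : 'I_(dimA A)) (j : 'I_(dimA B)) :
    graph p (pt i) (pt j) <-> graph q (pt i) (pt j).
  have /matrixP/(_ 0 j) := pq (delta_mx 0 i); rewrite /= -!rowE !mxE.
  case: asboolP => hp; case: asboolP => hq //= /eqP; first by rewrite oner_eq0.
  by rewrite eq_sym oner_eq0.
by move=> x y; split=> h; have [Ax By] := graph_sub h;
  have [i ix] := pt_surj Ax; have [j jy] := pt_surj By; subst; apply/E.
Qed.

End Linearization.

Lemma restr_star (Omega : Type) (K : subgroup Omega) (g : K) (A B : set Omega) :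
  pb_star (restr g A B) = restr (g^-1 : K)%g B A.
Proof.
apply: pbijP => x y /=; split=> -[Ay Bx E]; split=> //; rewrite -E.
  by rewrite [LHS]sg_valK.
by rewrite [LHS]sg_valVK.
Qed.

Local Open Scope card_scope.

Theorem theorem2p5 (R : realType) (Omega : Type)
    (countableOmega : [set: Omega] #= [set: nat])
    (K : subgroup Omega) (perfK : perfect_oligomorphic K) :
  (* (a) *)
  (exists (Phi : forall A B : perfset K, rdcoset R A B -> @mor (Tra K) B A)
          (circ : forall A B C : perfset K,
             rdcoset R A B -> rdcoset R B C -> rdcoset R A C)
          (inv : forall A B : perfset K, rdcoset R A B -> rdcoset R B A),
     [/\ forall (A B : perfset K) (g1 g2 : K),
           rdc R A B g1 = rdc R A B g2 <-> tra_restr g1 B A = tra_restr g2 B A,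
         (forall (A B : perfset K) (g : K),
            Phi A B (rdc R A B g) = tra_restr g B A) /\
         (forall A B : perfset K, bijective (Phi A B)),
         forall (A B C : perfset K) (p : rdcoset R A B) (q : rdcoset R B C)
           (rho : urep R K),
           rdc_tilde rho p \o rdc_tilde rho q = rdc_tilde rho (circ A B C p q),
         forall (A B C : perfset K) (p : rdcoset R A B) (q : rdcoset R B C),
           Phi A C (circ A B C p q) = mcomp (Phi A B p) (Phi B C q) &
         (forall (A B : perfset K) (g : K),
            inv A B (rdc R A B g) = rdc R B A (g^-1)%g) /\
         (forall (A B : perfset K) (p : rdcoset R A B),
            Phi B A (inv A B p) = mstar (Phi A B p))]) /\
  (* (b) *)
  [/\ forall (rho : urep R K) (A B : perfset K) (g : K),
        @oper R (Tra K) (tilde rho) B A (tra_restr g B A) = tilde_op rho A B g,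
      forall rho : urep R K, star_rep (tilde rho),
      forall rho rho' : urep R K,
        urep_equiv rho rho' <-> star_rep_equiv (tilde rho) (tilde rho') &
      forall T : opsys R (Tra K), star_rep T ->
        exists rho : urep R K, star_rep_equiv (tilde rho) T].
Proof.
have rdcE (A B : perfset K) (g1 g2 : K) :
    rdc R A B g1 = rdc R A B g2 <-> tra_restr g1 B A = tra_restr g2 B A.
  split=> [/rdcP E|/(congr1 (@tpb _ _ _ _)) /= E]; last first.
    by apply/rdcP => rho; apply: tilde_op_restr.
  (* Elements equal in every representation are equal in the one realizing the linearization, where
     distinct partial bijections act differently. *)
  have [U [Uu UT]] := tilde_model perfK (lin_srep R K) countableOmega.
  apply: (@lin_faithful R) => w; have [_ _ Usurj] := Uu B.
  by have [v <-] := Usurj w; rewrite !UT !(oper_tilde perfK) E.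
pose Phi (A B : perfset K) (p : rdcoset R A B) : @mor (Tra K) B A :=
  tra_restr (repr p) B A.
pose el (A B : perfset K) (m : @mor (Tra K) B A) : K := sval (cid (tpbP m)).
have elE (A B : perfset K) (m : @mor (Tra K) B A) : tra_restr (el A B m) B A = m.
  by apply: trahomP; rewrite [RHS]trahom_rep.
have rdcK (A B : perfset K) (p : rdcoset R A B) : rdc R A B (repr p) = p by exact: reprK.
have PhiE (A B : perfset K) (g : K) : Phi A B (rdc R A B g) = tra_restr g B A.
  by apply/rdcE; rewrite rdcK.
have starE (A B : perfset K) (g : K) :
    @mstar (Tra K) _ _ (tra_restr g B A) = tra_restr g^-1%g A B.
  by apply: trahomP; exact: restr_star.
split.
  (* The product of two cosets is the coset of any group element inducing the product of their
     partial bijections. *)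
  exists Phi, (fun A B C p q => rdc R A C (el A C (mcomp (Phi A B p) (Phi B C q)))),
    (fun A B p => rdc R B A (repr p)^-1%g); split.
  - exact: rdcE.
  - split=> // A B; exists (fun m => rdc R A B (el A B m)) => [p|m]; last by rewrite PhiE elE.
    by rewrite -[RHS]rdcK; apply/rdcE; rewrite elE.
  - move=> A B C p q rho; rewrite rdc_tildeE; apply: tilde_op_comp => //.
    by have /(congr1 (@tpb _ _ _ _)) := elE A C (mcomp (Phi A B p) (Phi B C q)).
  - by move=> A B C p q; rewrite PhiE elE.
  - split=> [A B g|A B p]; last by rewrite PhiE starE.
    by apply/rdcE; rewrite -!starE; rewrite -[tra_restr (repr _) _ _]/(Phi A B _) PhiE.
split.
- by move=> rho A B g; apply: oper_tilde.
- by move=> rho; apply: tilde_star_rep.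
- move=> rho rho'; split=> [|E]; first exact: urep_equiv_tilde.
  (* Each representation is rebuilt from its own [tilde] by the model, and the model respects
     equivalence. *)
  apply: urep_equiv_trans (urep_equiv_model countableOmega perfK rho) _.
  apply: urep_equiv_trans (urep_equiv_sym (urep_equiv_model countableOmega perfK rho')).
  exact: model_functorial.
- by move=> T sT; exists (model perfK (SRep sT) countableOmega); exact: tilde_model.
Qed.
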